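(* Let $\Sigma=(X,\Sigma_c,\mathcal U_2,g,\phi,\mathcal E)$, $\mathcal E=\{\tau_k\}_{k=0}^\infty$, be an impulsive system satisfying Assumption A, and suppose that it possesses an ISS-Lyapunov function $V$, with associated functions $W$, $\chi$, $\varphi_1,\varphi_2,\psi_1,\psi_2$ (all notions as defined in the context). Assume that for some constants $\theta_1\le\theta_2$ and $\delta>0$ the following holds for all $a>0$: $$\int_a^{\psi_1(a)}\frac{ds}{\varphi_1(s)}\le\theta_1-\delta,\qquad \int_{\psi_2(a)}^{a}\frac{ds}{\varphi_2(s)}\ge\theta_2+\delta .$$ Then for any sequence of impulse times $\mathcal E$ whose dwell-times $T_k=\tau_{k+1}-\tau_k$ satisfy $\theta_1\le T_k\le\theta_2$ for all $k\in\mathbb Z_+$, the system $\Sigma$ is input-to-state stable (ISS).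
   Context: Comparison functions (all continuous). $\mathcal P=\{\gamma:\mathbb R_+\to\mathbb R_+ : \gamma(r)=0\Leftrightarrow r=0\}$; $\mathcal K=\{\gamma\in\mathcal P:\gamma$ strictly increasing$\}$; $\mathcal K_\infty=\{\gamma\in\mathcal K:\gamma$ unbounded$\}$; $\mathcal L=\{\gamma:\mathbb R_+\to\mathbb R_+$ decreasing with $\lim_{t\to\infty}\gamma(t)=0\}$; $\mathcal{KL}=\{\beta:\mathbb R_+\times\mathbb R_+\to\mathbb R_+ : \beta(\cdot,t)\in\mathcal K,\ \beta(s,\cdot)\in\mathcal L\}$. If negative times occur, a $\mathcal{KL}$ function evaluated at time $t\ge t_0$ is understood as defined on $\mathbb R_+\times[t_0,\infty)$ with the same properties. Continuous dynamics $\Sigma_c=(X,\mathcal U_1,\phi_c)$. $X$ is a Banach space with norm $\|\cdot\|=\|\cdot\|_X$. $U_1$ is a nonempty subset of a normed space and $\mathcal U_1\subset\{f:\mathbb R\to U_1\}$ is a space of input signals normed by $\|\cdot\|_{\mathcal U_1}$, invariant under the time shifts $(\mathcal S_\tau u)(t)=u(t+\tau)$, $\tau\in\mathbb R$, with $\|\mathcal S_\tau\|\le 1$, and closed under concatenation (if $u_1,u_2\in\mathcal U_1$, $t\ge t_0$, $u=u_1$ on $[t_0,t]$ and $u=u_2$ on $(t,\infty)$, then $u\in\mathcal U_1$). The map $\phi_c(t,t_0,x,d_1)\in X$ is defined for $(t_0,x,d_1)\in\mathbb R\times X\times\mathcal U_1$ and $t\in[t_0,t_0+\epsilon_{t_0,x,d_1})$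 with some $\epsilon_{t_0,x,d_1}>0$, and satisfies: (1) $t\mapsto\phi_c(t,t_0,x,d_1)$ is continuous on $(t_0,t_0+\epsilon_{t_0,x,d_1})$ and $\lim_{t\to t_0+}\phi_c(t,t_0,x,d_1)=x$; (2) $\phi_c(t,t,x,d_1)=x$; (3) if $d_1=\tilde d_1$ on $[t_0,t]$, then $\phi_c(t,t_0,x,d_1)=\phi_c(t,t_0,x,\tilde d_1)$; (4) $\phi_c(t,t_0,x,d_1)=\phi_c(t,\tau,\phi_c(\tau,t_0,x,d_1),d_1)$ for $t\ge\tau\ge t_0$ whenever these are defined; (5) $\epsilon_{t_0+\tau,x,d_1}=\epsilon_{t_0,x,\mathcal S_\tau d_1}$ and $\phi_c(t+\tau,t_0+\tau,x,d_1)=\phi_c(t,t_0,x,\mathcal S_\tau d_1)$. Impulsive system $\Sigma=(X,\Sigma_c,\mathcal U_2,g,\phi,\mathcal E)$. $\mathcal E=\{\tau_k\}_{k=0}^\infty\subset\mathbb R$ is strictly increasing with $\tau_k\to\infty$; $U_2$ is a nonempty subset of a normed space; $\mathcal U_2\subset\{f:\mathbb Z_+\to U_2\}$ is a space of signals normed by $\|\cdot\|_{\mathcal U_2}$, with $\|d_2(k)\|_{U_2}\le\|d_2\|_{\mathcal U_2}$ for all $k$; $g:X\times U_2\to X$. With $p(t_0)=\min\{k\in\mathbb Z_+:\tau_k\ge t_0\}$ and $T_k=\tau_{k+1}-\tau_k$ it is required that $\tau_{p(t_0)}-t_0<\epsilon_{t_0,x,d_1}$ and $T_k<\epsilon_{\tau_k,x,d_1}$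 for all $k,t_0,x,d_1$. The map $\phi(t,t_0,x,d_1,d_2)$, $t\ge t_0$, is given by $\phi(t,t_0,x,d_1,d_2)=\phi_c(t,t_0,x,d_1)$ for $t\in[t_0,\tau_{p(t_0)}]$, and $\phi(t,t_0,x,d_1,d_2)=\phi_c(t,\tau_k,g(\phi(\tau_k,t_0,x,d_1,d_2),d_2(k)),d_1)$ for $t\in(\tau_k,\tau_{k+1}]$, $k\ge p(t_0)$. Put $\phi(\tau_k^+,t_0,x,d_1,d_2)=g(\phi(\tau_k,t_0,x,d_1,d_2),d_2(k))$ and $d=\max\{\|d_1\|_{\mathcal U_1},\|d_2\|_{\mathcal U_2}\}$. Assumption A. There are $\xi,\eta\in\mathcal K_\infty$ and, for each $\tau\in\mathbb R_+$, $\xi_\tau,\eta_\tau\in\mathcal K_\infty$ such that $\|\phi_c(t,0,x,d_1)\|\le\xi_\tau(\|x\|)+\eta_\tau(\|d_1\|_{\mathcal U_1})$ for all $t\in[0,\tau]$ (for which the left side is defined) and $(x,d_1)\in X\times\mathcal U_1$, and $\|g(x,d_2(k))\|\le\xi(\|x\|)+\eta(\|d_2\|_{\mathcal U_2})$ for all $(x,d_2)\in X\times\mathcal U_2$, $k\in\mathbb Z_+$. ISS. For a fixed $\mathcal E$, $\Sigma$ is ISS if for every $t_0$ there exist $\beta_{t_0}\in\mathcal{KL}$, $\gamma_{t_0}\in\mathcal K_\infty$ such that $\|\phi(t,t_0,x,d_1,d_2)\|_X\le\beta_{t_0}(\|x\|_X,t)+\gamma_{t_0}(d)$ for all $t\ge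 t_0$, $x\in X$, $(d_1,d_2)\in\mathcal U_1\times\mathcal U_2$. Lie derivative. For $V:X\to\mathbb R$: $\dot V(x,\xi)=\lim_{t\to0+}\frac1t\big(V(\phi_c(t,0,x,\xi))-V(x)\big)$, $(x,\xi)\in X\times\mathcal U_1$; similarly $\dot W$. ISS-Lyapunov function. A continuous $V:X\to\mathbb R_+$ such that $\alpha_1(\|x\|_X)\le V(x)\le\alpha_2(\|x\|_X)$ for all $x\in X$ with some $\alpha_1,\alpha_2\in\mathcal K_\infty$, and such that there exist $W\in C(X,\mathbb R)$ with $W(0)=0$, $\chi\in\mathcal K_\infty$ and $\varphi_i,\psi_i\in\mathcal P$ ($i=1,2$) for which: $\dot V(x,\xi)$ and $\dot W(x,\xi)$ exist for all $(x,\xi)\in X\times\mathcal U_1$; the sets $G^+=\{x:W(x)\ge0\}$, $G^-=\{x:W(x)\le0\}$ are nonempty; for $x\in G^-$ with $\|x\|_X\ge\max\{\chi(\|\xi\|_{\mathcal U_1}),\chi(\|\mu\|_{U_2})\}$ one has $\dot V(x,\xi)\le-\varphi_1(V(x))$ and $V(g(x,\mu))\le\psi_1(V(x))$; for $x\in G^+$ with $\|x\|_X\ge\max\{\chi(\|\xi\|_{\mathcal U_1}),\chi(\|\mu\|_{U_2})\}$ one has $\dot V(x,\xi)\le\varphi_2(V(x))$ and $V(g(x,\mu))\le\psi_2(V(x))$; and $W(x)=0$, $x\ne0$, $\|x\|\ge\chi(\|\xi\|_{\mathcal U_1})$ imply $\dot W(x,\xi)>0$. (Here $\xi\in\mathcal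 U_1$, $\mu\in U_2$.) *)

(* Defs.v *)
From Stdlib Require Import Reals.
From Coquelicot Require Import Coquelicot.
Open Scope R_scope.

Set Implicit Arguments.
Unset Strict Implicit.
Unset Printing Implicit Defensive.

(* A function on [0, oo) is a total function [R -> R] of which only the
   restriction to the nonnegative reals is constrained. *)

Definition class_P (g : R -> R) : Prop :=
  (forall r, 0 <= r -> 0 <= g r) /\
  continuous_on (fun r => 0 <= r) g /\
  (forall r, 0 <= r -> (g r = 0 <-> r = 0)).

Definition class_K (g : R -> R) : Prop :=
  class_P g /\ (forall r s, 0 <= r -> r < s -> g r < g s).

Definition class_Kinf (g : R -> R) : Prop :=
  class_K g /\ (forall M, exists r, 0 <= r /\ M < g r).

(* The time domain is [T, oo).  Decrease is not strict: a KL function vanishes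
   identically in time at s = 0. *)
Definition class_L (T : R) (g : R -> R) : Prop :=
  (forall t, T <= t -> 0 <= g t) /\
  continuous_on (fun t => T <= t) g /\
  (forall s t, T <= s -> s <= t -> g t <= g s) /\
  is_lim g p_infty 0.

Definition class_KL (T : R) (b : R -> R -> R) : Prop :=
  continuous_on (fun p : R * R => 0 <= fst p /\ T <= snd p)
    (fun p : R * R => b (fst p) (snd p)) /\
  (forall t, T <= t -> class_K (fun s => b s t)) /\
  (forall s, 0 <= s -> class_L T (b s)).

(* [U] need not be a linear subspace, so the set [sig_mem] of signals need not
   be one either; its norm is the restriction of a norm given on a linear
   space [sig_lin] of functions containing it. *)

Record signal_space (I : Type) (E : NormedModule R_AbsRing) (U : E -> Prop) := {
  sig_lin : (I -> E) -> Prop;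
  sig_norm : (I -> E) -> R;
  sig_mem : (I -> E) -> Prop;
  sig_lin_zero : sig_lin (fun _ => zero);
  sig_lin_plus : forall u v, sig_lin u -> sig_lin v ->
    sig_lin (fun i => plus (u i) (v i));
  sig_lin_scal : forall (a : R) u, sig_lin u -> sig_lin (fun i => scal a (u i));
  sig_norm_triangle : forall u v, sig_lin u -> sig_lin v ->
    sig_norm (fun i => plus (u i) (v i)) <= sig_norm u + sig_norm v;
  sig_norm_scal : forall (a : R) u, sig_lin u ->
    sig_norm (fun i => scal a (u i)) = Rabs a * sig_norm u;
  sig_norm_eq0 : forall u, sig_lin u -> sig_norm u = 0 ->
    forall i, u i = zero;
  sig_mem_lin : forall u, sig_mem u -> sig_lin u;
  sig_mem_val : forall u, sig_mem u -> forall i, U (u i);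
  sig_val_nonempty : exists a, U a
}.

Definition shift (E : Type) (tau : R) (u : R -> E) : R -> E :=
  fun t => u (t + tau).

(* The concatenation is prescribed on [t0, oo) only, so what is required is
   that some admissible signal has the prescribed values there. *)
Definition admissible_inputs (E : NormedModule R_AbsRing) (U : E -> Prop)
    (S : signal_space R U) : Prop :=
  (forall u tau, sig_mem S u -> sig_mem S (shift tau u)) /\
  (forall u tau, sig_mem S u -> sig_norm S (shift tau u) <= sig_norm S u) /\
  (forall u1 u2 t0 t, sig_mem S u1 -> sig_mem S u2 -> t0 <= t ->
     exists u, sig_mem S u /\
       (forall s, t0 <= s <= t -> u s = u1 s) /\
       (forall s, t < s -> u s = u2 s)).

(* [flow t t0 x d] is meaningful for [0 <= t - t0 < lifetime t0 x d] and
   [sig_mem S d] only; the lifetime may be infinite. *)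

Definition defined_at (X D : Type) (life : R -> X -> D -> Rbar)
    (t t0 : R) (x : X) (d : D) : Prop :=
  t0 <= t /\ Rbar_lt (t - t0) (life t0 x d).

Record continuous_dynamics (X : CompleteNormedModule R_AbsRing)
    (E : NormedModule R_AbsRing) (U : E -> Prop) (S : signal_space R U) := {
  flow : R -> R -> X -> (R -> E) -> X;
  lifetime : R -> X -> (R -> E) -> Rbar;
  inputs_admissible : admissible_inputs S;
  lifetime_pos : forall t0 x d, sig_mem S d -> Rbar_lt 0 (lifetime t0 x d);
  flow_continuous : forall t t0 x d, sig_mem S d ->
    t0 < t -> Rbar_lt (t - t0) (lifetime t0 x d) ->
    continuous (fun s => flow s t0 x d) t;
  flow_right_limit : forall t0 x d, sig_mem S d ->
    filterlim (fun s => flow s t0 x d) (at_right t0) (locally x);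
  flow_id : forall t x d, sig_mem S d -> flow t t x d = x;
  flow_causal : forall t t0 x d d', sig_mem S d -> sig_mem S d' ->
    (forall s, t0 <= s <= t -> d s = d' s) ->
    defined_at lifetime t t0 x d -> defined_at lifetime t t0 x d' ->
    flow t t0 x d = flow t t0 x d';
  flow_cocycle : forall t tau t0 x d, sig_mem S d ->
    t0 <= tau -> tau <= t ->
    defined_at lifetime t t0 x d -> defined_at lifetime tau t0 x d ->
    defined_at lifetime t tau (flow tau t0 x d) d ->
    flow t t0 x d = flow t tau (flow tau t0 x d) d;
  lifetime_shift : forall t0 tau x d, sig_mem S d ->
    lifetime (t0 + tau) x d = lifetime t0 x (shift tau d);
  flow_shift : forall t t0 tau x d, sig_mem S d ->
    defined_at lifetime t t0 x (shift tau d) ->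
    flow (t + tau) (t0 + tau) x d = flow t t0 x (shift tau d)
}.

Section Impulsive.

Variables (X : CompleteNormedModule R_AbsRing) (E1 E2 : NormedModule R_AbsRing).
Variables (U1 : E1 -> Prop) (U2 : E2 -> Prop).
Variables (S1 : signal_space R U1) (S2 : signal_space nat U2).
Variable Sc : continuous_dynamics X S1.
(* The jump map; only its values at second arguments in [U2] matter. *)
Variable g : X -> E2 -> X.

(* [p = min {k | t0 <= tau k}]. *)
Definition first_impulse (tau : nat -> R) (t0 : R) (p : nat) : Prop :=
  t0 <= tau p /\ (forall j, (j < p)%nat -> tau j < t0).

(* [traj_first] and [traj_next] determine [phi t t0 x d1 d2] for all
   [t >= t0]. *)
Record impulsive_system (tau : nat -> R)
    (phi : R -> R -> X -> (R -> E1) -> (nat -> E2) -> X) : Prop := {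
  impulses_incr : forall k, tau k < tau (S k);
  impulses_lim : is_lim_seq tau p_infty;
  jump_input_bound : forall d2 k, sig_mem S2 d2 -> norm (d2 k) <= sig_norm S2 d2;
  life_first : forall t0 x d1 p, sig_mem S1 d1 -> first_impulse tau t0 p ->
    Rbar_lt (tau p - t0) (lifetime Sc t0 x d1);
  life_next : forall k x d1, sig_mem S1 d1 ->
    Rbar_lt (tau (S k) - tau k) (lifetime Sc (tau k) x d1);
  traj_first : forall t t0 x d1 d2 p, sig_mem S1 d1 -> sig_mem S2 d2 ->
    first_impulse tau t0 p -> t0 <= t <= tau p ->
    phi t t0 x d1 d2 = flow Sc t t0 x d1;
  traj_next : forall t t0 x d1 d2 p k, sig_mem S1 d1 -> sig_mem S2 d2 ->
    first_impulse tau t0 p -> (p <= k)%nat -> tau k < t <= tau (S k) ->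
    phi t t0 x d1 d2 =
      flow Sc t (tau k) (g (phi (tau k) t0 x d1 d2) (d2 k)) d1
}.

Definition assumption_A : Prop :=
  (forall tau, 0 <= tau ->
     exists xi_tau eta_tau, class_Kinf xi_tau /\ class_Kinf eta_tau /\
       forall t x d1, sig_mem S1 d1 -> 0 <= t <= tau ->
         defined_at (lifetime Sc) t 0 x d1 ->
         norm (flow Sc t 0 x d1) <= xi_tau (norm x) + eta_tau (sig_norm S1 d1)) /\
  (exists xi eta, class_Kinf xi /\ class_Kinf eta /\
     forall x d2 k, sig_mem S2 d2 ->
       norm (g x (d2 k)) <= xi (norm x) + eta (sig_norm S2 d2)).

(* The time domain of the KL bound is [0, oo), enlarged to [t0, oo) when
   [t0 < 0]. *)
Definition ISS (phi : R -> R -> X -> (R -> E1) -> (nat -> E2) -> X) : Prop :=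
  forall t0, exists beta gamma,
    class_KL (Rmin 0 t0) beta /\ class_Kinf gamma /\
    forall t x d1 d2, t0 <= t -> sig_mem S1 d1 -> sig_mem S2 d2 ->
      norm (phi t t0 x d1 d2) <=
        beta (norm x) t + gamma (Rmax (sig_norm S1 d1) (sig_norm S2 d2)).

Definition is_lie_derivative (V : X -> R) (x : X) (xi : R -> E1) (l : R) : Prop :=
  filterlim (fun t => / t * (V (flow Sc t 0 x xi) - V x)) (at_right 0) (locally l).

Record ISS_Lyapunov (V W : X -> R) (chi phi1 phi2 psi1 psi2 : R -> R) : Prop := {
  lyap_V_continuous : forall x, continuous V x;
  lyap_V_nonneg : forall x, 0 <= V x;
  lyap_V_bounds : exists alpha1 alpha2, class_Kinf alpha1 /\ class_Kinf alpha2 /\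
    forall x, alpha1 (norm x) <= V x <= alpha2 (norm x);
  lyap_W_continuous : forall x, continuous W x;
  lyap_W_zero : W zero = 0;
  lyap_chi : class_Kinf chi;
  lyap_phi1 : class_P phi1;
  lyap_phi2 : class_P phi2;
  lyap_psi1 : class_P psi1;
  lyap_psi2 : class_P psi2;
  lyap_V_diff : forall x xi, sig_mem S1 xi -> exists l, is_lie_derivative V x xi l;
  lyap_W_diff : forall x xi, sig_mem S1 xi -> exists l, is_lie_derivative W x xi l;
  lyap_Gplus_nonempty : exists x, 0 <= W x;
  lyap_Gminus_nonempty : exists x, W x <= 0;
  lyap_Gminus : forall x xi mu, sig_mem S1 xi -> U2 mu -> W x <= 0 ->
    Rmax (chi (sig_norm S1 xi)) (chi (norm mu)) <= norm x ->
    (forall l, is_lie_derivative V x xi l -> l <= - phi1 (V x)) /\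
    V (g x mu) <= psi1 (V x);
  lyap_Gplus : forall x xi mu, sig_mem S1 xi -> U2 mu -> 0 <= W x ->
    Rmax (chi (sig_norm S1 xi)) (chi (norm mu)) <= norm x ->
    (forall l, is_lie_derivative V x xi l -> l <= phi2 (V x)) /\
    V (g x mu) <= psi2 (V x);
  lyap_W_crossing : forall x xi, sig_mem S1 xi -> W x = 0 -> x <> zero ->
    chi (sig_norm S1 xi) <= norm x ->
    forall l, is_lie_derivative W x xi l -> 0 < l
}.

End Impulsive.

(* Main.v *)
Require Import Defs.
From Stdlib Require Import Reals Lra Lia Wf_nat ClassicalEpsilon FunctionalExtensionality.
From Coquelicot Require Import Coquelicot.
Open Scope R_scope.

(* Fix the input size [D]. If the state stays outside the ball of radius
   [chi D] between two consecutive impulses, then the value of [V] just after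
   an impulse decreases to the next one by at least [delta], measured by
   [H v = RInt (1/m) 1 v] with [m = min (phi1, phi2, id)].
   Indeed the set [W >= 0] is forward invariant for the flow there, so if
   [W < 0] at the end of the period then [W <= 0] throughout it, [V] has
   decreased for a time at least [theta1], and the integral condition on
   [psi1] applies; otherwise [V' <= phi2 V] throughout, since this also follows
   from [V' <= - phi1 V], and the condition on [psi2] applies.  If the ball is
   entered, Assumption A bounds the next post-jump value by a class K function
   of [D].
   As [m <= id], [H] maps [(0, oo)] onto the line, and [H^-1 (H s - t)] is a KL
   function, dominating the post-jump values at [t = k delta].  The behaviour
   between jumps is again controlled by Assumption A. *)

(** * Right derivatives *)

(** The supremum of the points up to which [P] holds satisfies [P] by the first or the third
    premise, and by the second it cannot lie before [b]. *)
Lemma real_induction (P : R -> Prop) (a b : R) :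
  P a ->
  (forall t, a <= t < b -> P t ->
     exists eta, 0 < eta /\ forall s, t < s < t + eta -> s <= b -> P s) ->
  (forall t, a < t <= b -> (forall s, a <= s < t -> P s) -> P t) ->
  forall t, a <= t <= b -> P t.
Proof.
  intros Ha Hright Hleft t Ht.
  set (E := fun s => a <= s <= b /\ forall r, a <= r <= s -> P r).
  assert (Ea : E a).
  { split; [lra | intros r Hr; replace r with a by lra; exact Ha]. }
  destruct (completeness E) as [m [Hub Hlub]].
  { exists b; intros s [Hs _]; lra. }
  { exists a; exact Ea. }
  assert (Ham : a <= m) by (apply Hub; exact Ea).
  assert (Hmb : m <= b) by (apply Hlub; intros s [Hs _]; lra).
  assert (Hlt : forall r, a <= r < m -> P r).
  { intros r Hr.
    destruct (classic (exists s, E s /\ r < s)) as [[s [[_ Hs] Hrs]] | Hno].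
    - apply Hs; lra.
    - assert (m <= r); [| lra].
      apply Hlub; intros s Es.
      destruct (Rle_lt_dec s r) as [H | H]; [exact H |].
      exfalso; apply Hno; exists s; split; assumption. }
  assert (HPm : P m).
  { destruct (Rle_lt_or_eq_dec _ _ Ham) as [H | H].
    - apply Hleft; [lra | exact Hlt].
    - rewrite <- H; exact Ha. }
  destruct (Rle_lt_or_eq_dec _ _ Hmb) as [H | H].
  - exfalso.
    destruct (Hright m) as [eta [Heta He]]; [lra | exact HPm |].
    pose (s := Rmin b (m + eta / 2)).
    assert (Hs : m < s <= m + eta / 2 /\ s <= b).
    { unfold s, Rmin; destruct (Rle_dec b (m + eta / 2)); lra. }
    assert (s <= m); [| lra].
    apply Hub; split; [lra |].
    intros r Hr.
    destruct (Rtotal_order r m) as [H1 | [H1 | H1]].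
    + apply Hlt; lra.
    + rewrite H1; exact HPm.
    + apply He; lra.
  - destruct (Req_dec t m) as [-> | Hn]; [exact HPm | apply Hlt; lra].
Qed.

(** The quotient has the shape used in [is_lie_derivative], so that along a trajectory the two
    notions differ only by a rewriting of the flow. *)
Definition is_right_derive (f : R -> R) (t l : R) : Prop :=
  filterlim (fun h => / h * (f (t + h) - f t)) (at_right 0) (locally l).

Lemma is_right_derive_eps (f : R -> R) (t l : R) :
  is_right_derive f t l ->
  forall eps, 0 < eps -> exists eta, 0 < eta /\
    forall h, 0 < h < eta -> Rabs (f (t + h) - f t - l * h) <= eps * h.
Proof.
  intros Hf eps Heps.
  destruct (proj1 (filterlim_locally _ _) Hf (mkposreal eps Heps)) as [eta Heta].
  exists eta; split; [apply cond_pos |].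
  intros h Hh.
  assert (Hb : Rabs (/ h * (f (t + h) - f t) - l) < eps).
  { apply (Heta h); [| lra].
    change (Rabs (h - 0) < eta); rewrite Rabs_pos_eq; lra. }
  replace (f (t + h) - f t - l * h) with (h * (/ h * (f (t + h) - f t) - l))
    by (field; lra).
  rewrite Rabs_mult, (Rabs_pos_eq h), Rmult_comm by lra.
  apply Rmult_le_compat_r; lra.
Qed.

(** The last premise says that the upper right Dini derivative is nonpositive. Real induction then
    keeps [f] below every line of positive slope through its value at [a]. *)
Lemma right_derive_le0_le (f : R -> R) (a b : R) :
  a <= b ->
  (forall t, a < t <= b -> filterlim f (at_left t) (locally (f t))) ->
  (forall t, a <= t < b -> forall eps, 0 < eps -> exists eta, 0 < eta /\
     forall h, 0 < h < eta -> f (t + h) - f t <= eps * h) ->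
  f b <= f a.
Proof.
  intros Hab Hl Hr.
  apply Rnot_lt_le; intros Hlt.
  (* With this slope the line rises by at most half of [f b - f a]; the [+ 1] keeps the denominator
     positive when [a = b]. *)
  pose (e := (f b - f a) / (2 * (b - a + 1))).
  assert (He : 0 < e) by (apply Rdiv_lt_0_compat; lra).
  assert (H : f b <= f a + e * (b - a)).
  { apply (real_induction (fun s => f s <= f a + e * (s - a)) a b); [lra | | | lra].
    - intros t Ht IH.
      destruct (Hr t Ht e He) as [eta [Heta Hh]].
      exists eta; split; [exact Heta |].
      intros s Hs _.
      assert (H1 := Hh (s - t)); replace (t + (s - t)) with s in H1 by ring.
      assert (H2 : f s - f t <= e * (s - t)) by (apply H1; lra).
      lra.
    - intros t Ht IH.
      apply Rnot_lt_le; intros Hc.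
      destruct (proj1 (filterlim_locally _ _) (Hl t Ht)
        (mkposreal (f t - (f a + e * (t - a))) ltac:(lra))) as [eta Heta].
      pose (s := Rmax a (t - eta / 2)).
      assert (Hs : a <= s < t /\ t - eta / 2 <= s).
      { pose proof (cond_pos eta); unfold s, Rmax.
        destruct (Rle_dec a (t - eta / 2)); lra. }
      assert (H1 : Rabs (f s - f t) < f t - (f a + e * (t - a))).
      { apply Heta; [| lra].
        change (Rabs (s - t) < eta); pose proof (cond_pos eta).
        rewrite Rabs_left1; lra. }
      apply Rabs_def2 in H1.
      assert (H2 := IH s ltac:(lra)).
      assert (0 <= e * (t - s)) by (apply Rmult_le_pos; lra).
      lra. }
  assert (e * (b - a) <= (f b - f a) / 2); [| lra].
  unfold e.
  replace ((f b - f a) / (2 * (b - a + 1)) * (b - a))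
    with ((f b - f a) / 2 * ((b - a) / (b - a + 1))) by (field; lra).
  rewrite <- (Rmult_1_r ((f b - f a) / 2)) at 2.
  apply Rmult_le_compat_l; [lra |].
  apply Rmult_le_reg_r with (b - a + 1); [lra |].
  unfold Rdiv; rewrite Rmult_assoc, Rinv_l; lra.
Qed.

(** Real induction: a positive value stays positive for a short time by right differentiability, a
    zero is left upwards because the derivative there is positive, and left continuity closes the
    interval. *)
Lemma nonneg_forward_invariant (w : R -> R) (a b : R) :
  0 <= w a ->
  (forall t, a < t <= b -> filterlim w (at_left t) (locally (w t))) ->
  (forall t, a <= t < b -> exists l, is_right_derive w t l) ->
  (forall t l, a <= t < b -> w t = 0 -> is_right_derive w t l -> 0 < l) ->
  forall t, a <= t <= b -> 0 <= w t.
Proof.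
  intros Ha Hl Hd Hpos.
  apply real_induction; [exact Ha | |].
  - intros t Ht Hw.
    destruct (Hd t Ht) as [l Hlim].
    destruct Hw as [Hw | Hw].
    + destruct (is_right_derive_eps w t l Hlim 1 Rlt_0_1) as [eta [Heta Hh]].
      (* To the right of [t], [w] lies above the line of slope [- (Rabs l + 1)] through [w t], which
         vanishes after exactly this time. *)
      assert (Hk : 0 < w t / (Rabs l + 1)).
      { apply Rdiv_lt_0_compat; [exact Hw | pose proof (Rabs_pos l); lra]. }
      exists (Rmin eta (w t / (Rabs l + 1))); split; [apply Rmin_case; assumption |].
      intros s Hs _.
      assert (Hs1 : s - t < eta) by (pose proof (Rmin_l eta (w t / (Rabs l + 1))); lra).
      assert (Hs2 : s - t < w t / (Rabs l + 1))
        by (pose proof (Rmin_r eta (w t / (Rabs l + 1))); lra).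
      assert (H1 := Hh (s - t) ltac:(lra)); replace (t + (s - t)) with s in H1 by ring.
      apply Rabs_le_between in H1.
      assert (H2 : - Rabs l * (s - t) <= l * (s - t)).
      { apply Rmult_le_compat_r; [lra |].
        pose proof (Rle_abs (- l)); rewrite Rabs_Ropp in H; lra. }
      assert (H3 : (s - t) * (Rabs l + 1) <= w t).
      { pose proof (Rabs_pos l).
        apply Rle_trans with (w t / (Rabs l + 1) * (Rabs l + 1)).
        - apply Rmult_le_compat_r; lra.
        - right; field; lra. }
      lra.
    + assert (Hlp : 0 < l) by (apply (Hpos t l Ht); [symmetry; exact Hw | exact Hlim]).
      (* The tolerated error is [l] itself: the linear growth [l * (s - t)] just compensates for
         it. *)
      destruct (is_right_derive_eps w t l Hlim l Hlp) as [eta [Heta Hh]].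
      exists eta; split; [exact Heta |].
      intros s Hs _.
      assert (H1 := Hh (s - t) ltac:(lra)); replace (t + (s - t)) with s in H1 by ring.
      apply Rabs_le_between in H1; lra.
  - intros t Ht IH.
    apply Rnot_lt_le; intros Hc.
    destruct (proj1 (filterlim_locally _ _) (Hl t Ht)
      (mkposreal (- w t) ltac:(lra))) as [eta Heta].
    pose (s := Rmax a (t - eta / 2)).
    assert (Hs : a <= s < t /\ t - eta / 2 <= s).
    { pose proof (cond_pos eta); unfold s, Rmax.
      destruct (Rle_dec a (t - eta / 2)); lra. }
    assert (H1 : Rabs (w s - w t) < - w t).
    { apply Heta; [| lra].
      change (Rabs (s - t) < eta); pose proof (cond_pos eta).
      rewrite Rabs_left1; lra. }
    apply Rabs_def2 in H1.
    assert (H2 := IH s ltac:(lra)).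
    lra.
Qed.

Lemma is_derive_eps (H : R -> R) (v k : R) :
  is_derive H v k ->
  forall eps, 0 < eps -> exists eta, 0 < eta /\
    forall y, Rabs (y - v) < eta -> Rabs (H y - H v - k * (y - v)) <= eps * Rabs (y - v).
Proof.
  intros [_ HH] eps Heps.
  destruct (HH v (fun P HP => HP) (mkposreal eps Heps)) as [eta Heta].
  exists eta; split; [apply cond_pos |].
  intros y Hy.
  assert (H1 := Heta y Hy).
  unfold norm, minus, plus, opp, scal in H1; simpl in H1.
  unfold mult, abs in H1; simpl in H1.
  replace (H y - H v - k * (y - v)) with (H y + - H v + - ((y + - v) * k)) by ring.
  exact H1.
Qed.

(** One-sided chain rule, in the form of the Dini estimate of [right_derive_le0_le]. Half of [eps]
    pays for the linearisation of [H], where [L] bounds the rate of change of [v]; the other half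
    pays for that of [v], multiplied by [k]. *)
Lemma right_derive_comp_le (H v : R -> R) (t k l m : R) :
  is_derive H (v t) k -> is_right_derive v t l -> k * l <= m ->
  forall eps, 0 < eps -> exists eta, 0 < eta /\
    forall h, 0 < h < eta -> H (v (t + h)) - H (v t) <= (m + eps) * h.
Proof.
  intros HH Hv Hm eps Heps.
  pose (L := Rabs l + 1).
  pose (K := Rabs k + 1).
  assert (HL : 0 < L) by (unfold L; pose proof (Rabs_pos l); lra).
  assert (HK : 0 < K) by (unfold K; pose proof (Rabs_pos k); lra).
  destruct (is_derive_eps H (v t) k HH (eps / (2 * L))) as [e1 [He1 H1]].
  { apply Rdiv_lt_0_compat; lra. }
  destruct (is_right_derive_eps v t l Hv 1 Rlt_0_1) as [e2 [He2 H2]].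
  destruct (is_right_derive_eps v t l Hv (eps / (2 * K))) as [e3 [He3 H3]].
  { apply Rdiv_lt_0_compat; lra. }
  assert (He4 : 0 < e1 / L) by (apply Rdiv_lt_0_compat; lra).
  exists (Rmin (e1 / L) (Rmin e2 e3)); split.
  { repeat apply Rmin_case; assumption. }
  intros h Hh.
  assert (Hh1 : h < e1 / L) by (pose proof (Rmin_l (e1 / L) (Rmin e2 e3)); lra).
  assert (Hh2 : h < e2 /\ h < e3).
  { pose proof (Rmin_r (e1 / L) (Rmin e2 e3)).
    pose proof (Rmin_l e2 e3); pose proof (Rmin_r e2 e3); lra. }
  specialize (H2 h ltac:(lra)); specialize (H3 h ltac:(lra)).
  set (y := v (t + h)) in *.
  assert (Hy : Rabs (y - v t) <= L * h).
  { replace (y - v t) with ((y - v t - l * h) + l * h) by ring.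
    eapply Rle_trans; [apply Rabs_triang |].
    rewrite Rabs_mult, (Rabs_pos_eq h) by lra.
    unfold L; lra. }
  assert (HyL : L * h < e1).
  { apply Rlt_le_trans with (L * (e1 / L)).
    - apply Rmult_lt_compat_l; lra.
    - right; field; lra. }
  specialize (H1 y ltac:(lra)).
  assert (A1 : Rabs (H y - H (v t) - k * (y - v t)) <= eps / 2 * h).
  { eapply Rle_trans; [exact H1 |].
    apply Rle_trans with (eps / (2 * L) * (L * h)).
    - apply Rmult_le_compat_l; [apply Rlt_le, Rdiv_lt_0_compat; lra | exact Hy].
    - right; field; lra. }
  assert (A2 : Rabs (k * (y - v t - l * h)) <= eps / 2 * h).
  { rewrite Rabs_mult.
    apply Rle_trans with (K * (eps / (2 * K) * h)).
    - apply Rmult_le_compat; try apply Rabs_pos; [unfold K; lra | exact H3].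
    - right; field; lra. }
  assert (A3 : k * l * h <= m * h) by (apply Rmult_le_compat_r; lra).
  apply Rabs_le_between in A1; apply Rabs_le_between in A2.
  lra.
Qed.

(** * Primitives of reciprocals of positive definite functions *)

Lemma class_P_pos (f : R -> R) (r : R) : class_P f -> 0 < r -> 0 < f r.
Proof.
  intros [Hnn [_ H0]] Hr.
  destruct (Hnn r ltac:(lra)) as [H | H]; [exact H |].
  symmetry in H; apply (H0 r ltac:(lra)) in H; lra.
Qed.

Lemma class_P_0 (f : R -> R) : class_P f -> f 0 = 0.
Proof. intros [_ [_ H0]]; apply H0; lra. Qed.

(** Continuity relative to the half line becomes plain continuity at an interior point, since a ball
    of radius at most [r] stays in the domain. *)
Lemma class_P_continuous (f : R -> R) (r : R) :
  class_P f -> 0 < r -> continuous f r.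
Proof.
  intros [_ [Hc _]] Hr P HP.
  specialize (Hc r ltac:(lra) P HP).
  destruct Hc as [e He].
  exists (mkposreal _ (Rmin_stable_in_posreal e (mkposreal r Hr))).
  intros y Hy.
  change (Rabs (y - r) < Rmin e r) in Hy.
  apply He.
  - change (Rabs (y - r) < e); pose proof (Rmin_l e r); lra.
  - pose proof (Rmin_r e r); apply Rabs_lt_between in Hy; lra.
Qed.

Lemma class_P_inv_continuous (f : R -> R) (r : R) :
  class_P f -> 0 < r -> continuous (fun s => / f s) r.
Proof.
  intros Hf Hr.
  apply (continuous_comp f Rinv); [apply class_P_continuous; assumption |].
  apply continuous_Rinv; apply Rgt_not_eq, class_P_pos; assumption.
Qed.

Lemma class_P_ex_RInt_inv (f : R -> R) (a b : R) :
  class_P f -> 0 < a -> 0 < b -> ex_RInt (fun s => / f s) a b.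
Proof.
  intros Hf Ha Hb; apply (ex_RInt_continuous (V := R_CompleteNormedModule)); intros z Hz.
  apply class_P_inv_continuous; [exact Hf |].
  pose proof (Rmin_glb_lt a b 0 Ha Hb); lra.
Qed.

(** The signed time that a solution of [y' = f(y)] takes from [1] to [v]. The base point is not [0],
    where [1/f] may fail to be integrable; only [v > 0] is meaningful. *)
Definition inv_primitive (f : R -> R) (v : R) : R := RInt (fun s => / f s) 1 v.

Lemma inv_primitive_minus (f : R -> R) (a b : R) :
  class_P f -> 0 < a -> 0 < b ->
  inv_primitive f b - inv_primitive f a = RInt (fun s => / f s) a b.
Proof.
  intros Hf Ha Hb; unfold inv_primitive.
  rewrite <- (RInt_Chasles (V := R_CompleteNormedModule) (fun s => / f s) 1 a b)
    by (apply class_P_ex_RInt_inv; trivial; lra).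
  unfold plus; simpl; ring.
Qed.

Lemma is_derive_inv_primitive (f : R -> R) (v : R) :
  class_P f -> 0 < v -> is_derive (inv_primitive f) v (/ f v).
Proof.
  intros Hf Hv.
  apply (is_derive_RInt (V := R_NormedModule) (fun s => / f s) (inv_primitive f) 1 v).
  - exists (mkposreal v Hv); intros y Hy.
    change (Rabs (y - v) < v) in Hy; apply Rabs_lt_between in Hy.
    apply (RInt_correct (V := R_CompleteNormedModule)).
    apply class_P_ex_RInt_inv; trivial; lra.
  - apply class_P_inv_continuous; assumption.
Qed.

Lemma inv_primitive_incr (f : R -> R) (a b : R) :
  class_P f -> 0 < a < b -> inv_primitive f a < inv_primitive f b.
Proof.
  intros Hf Hab.
  assert (H : 0 < RInt (fun s => / f s) a b).
  { apply RInt_gt_0; [lra | |].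
    - intros x Hx; apply Rinv_0_lt_compat, class_P_pos; [exact Hf | lra].
    - intros x Hx; apply class_P_inv_continuous; [exact Hf | lra]. }
  rewrite <- inv_primitive_minus in H by (trivial; lra); lra.
Qed.

Lemma inv_primitive_lt_reg (f : R -> R) (a b : R) :
  class_P f -> 0 < a -> 0 < b -> inv_primitive f a < inv_primitive f b -> a < b.
Proof.
  intros Hf Ha Hb H.
  destruct (Rtotal_order a b) as [H1 | [-> | H1]]; [exact H1 | lra |].
  pose proof (inv_primitive_incr f b a Hf); lra.
Qed.

Lemma inv_primitive_le (f : R -> R) (a b : R) :
  class_P f -> 0 < a <= b -> inv_primitive f a <= inv_primitive f b.
Proof.
  intros Hf [Ha [Hab | ->]]; [| lra].
  apply Rlt_le, inv_primitive_incr; [exact Hf | lra].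
Qed.

(** A smaller rate takes a longer time. This transfers a decrease measured with [phi1] or [phi2] to
    their common minorant. *)
Lemma inv_primitive_minus_le (f h : R -> R) (a b : R) :
  class_P f -> class_P h -> (forall r, 0 < r -> h r <= f r) -> 0 < a <= b ->
  inv_primitive f b - inv_primitive f a <= inv_primitive h b - inv_primitive h a.
Proof.
  intros Hf Hh Hle Hab.
  rewrite !inv_primitive_minus by (trivial; lra).
  apply RInt_le; [lra | | |].
  - apply class_P_ex_RInt_inv; trivial; lra.
  - apply class_P_ex_RInt_inv; trivial; lra.
  - intros x Hx; apply Rinv_le_contravar; [| apply Hle; lra].
    apply class_P_pos; [exact Hh | lra].
Qed.

(** Separation of variables: dividing the differential inequality by [f (v t)] bounds the right
    derivative of [inv_primitive f (v t)] by [c]. The cases of interest are [c = 1] and [c = -1]. *)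
Lemma inv_primitive_right_derive_le (f v : R -> R) (a b c : R) :
  class_P f -> a <= b ->
  (forall t, a <= t <= b -> 0 < v t) ->
  (forall t, a < t <= b -> filterlim v (at_left t) (locally (v t))) ->
  (forall t, a <= t < b -> exists l, is_right_derive v t l /\ l <= c * f (v t)) ->
  inv_primitive f (v b) <= inv_primitive f (v a) + c * (b - a).
Proof.
  intros Hf Hab Hv Hl Hd.
  assert (H : inv_primitive f (v b) - c * b <= inv_primitive f (v a) - c * a); [| lra].
  apply (right_derive_le0_le (fun t => inv_primitive f (v t) - c * t) a b Hab).
  - intros t Ht.
    apply (filterlim_comp_2 (G := locally (inv_primitive f (v t))) (H := locally (- (c * t)))
      (fun s => inv_primitive f (v s)) (fun s => - (c * s)) Rplus).
    + eapply filterlim_comp; [apply Hl, Ht |].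
      apply (ex_derive_continuous (V := R_NormedModule)).
      eexists; apply is_derive_inv_primitive; [exact Hf | apply Hv; lra].
    + eapply filterlim_filter_le_1; [apply filter_le_within |].
      apply (ex_derive_continuous (V := R_NormedModule) (fun s => - (c * s))).
      auto_derive; trivial.
    + apply (filterlim_plus (V := R_NormedModule)).
  - intros t Ht eps Heps.
    destruct (Hd t Ht) as [l [Hl1 Hl2]].
    assert (Hp : 0 < f (v t)) by (apply class_P_pos; [exact Hf | apply Hv; lra]).
    destruct (right_derive_comp_le (inv_primitive f) v t (/ f (v t)) l c) with (eps := eps)
      as [eta [Heta Hh]]; trivial.
    + apply is_derive_inv_primitive; [exact Hf | apply Hv; lra].
    + apply Rmult_le_reg_l with (f (v t)); [exact Hp |].
      rewrite <- Rmult_assoc, Rinv_r, Rmult_1_l by lra; lra.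
    + exists eta; split; [exact Heta |].
      intros h Hhh; specialize (Hh h Hhh); lra.
Qed.

(** * One period between impulses, for scalar functions *)

(** Here [v] and [w] stand for [V] and [W] along the trajectory and [v'] for the value of [V] after
    the jump. The sign of [w T] selects the case; [T <= theta2] limits the growth in one,
    [theta1 <= T] guarantees enough decay in the other. *)
Lemma hybrid_step (phi1 phi2 psi1 psi2 m v w : R -> R) (theta1 theta2 delta T v' : R) :
  class_P phi1 -> class_P phi2 -> class_P psi1 -> class_P psi2 -> class_P m ->
  (forall r, 0 < r -> m r <= phi1 r) -> (forall r, 0 < r -> m r <= phi2 r) ->
  0 < delta ->
  (forall a, 0 < a -> RInt (fun s => / phi1 s) a (psi1 a) <= theta1 - delta) ->
  (forall a, 0 < a -> theta2 + delta <= RInt (fun s => / phi2 s) (psi2 a) a) ->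
  0 <= T -> theta1 <= T <= theta2 ->
  (forall t, 0 <= t <= T -> 0 < v t) ->
  (forall t, 0 < t <= T -> filterlim v (at_left t) (locally (v t))) ->
  (forall t, 0 < t <= T -> filterlim w (at_left t) (locally (w t))) ->
  (forall t, 0 <= t < T -> exists l, is_right_derive v t l /\
     (w t <= 0 -> l <= - phi1 (v t)) /\ (0 <= w t -> l <= phi2 (v t))) ->
  (forall t, 0 <= t < T -> exists l, is_right_derive w t l) ->
  (forall t l, 0 <= t < T -> w t = 0 -> is_right_derive w t l -> 0 < l) ->
  0 < v' ->
  (w T <= 0 -> v' <= psi1 (v T)) -> (0 <= w T -> v' <= psi2 (v T)) ->
  inv_primitive m v' <= inv_primitive m (v 0) - delta.
Proof.
  intros Hphi1 Hphi2 Hpsi1 Hpsi2 Hm Hm1 Hm2 Hdelta H1 H2 HT0 HT Hv Hvl Hwl Hvd Hwd Hcross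
    Hv' Hj1 Hj2.
  assert (HvT : 0 < v T) by (apply Hv; lra).
  assert (Hv0 : 0 < v 0) by (apply Hv; lra).
  (* A decrease measured with one [f] above [m] suffices: it forces [v' < v 0], and the distance
     between these two values only grows when measured with [m]. *)
  assert (Hfin : forall f, class_P f -> (forall r, 0 < r -> m r <= f r) ->
    inv_primitive f v' <= inv_primitive f (v 0) - delta ->
    inv_primitive m v' <= inv_primitive m (v 0) - delta).
  { intros f Hf Hle H.
    assert (v' < v 0) by (apply (inv_primitive_lt_reg f); trivial; lra).
    pose proof (inv_primitive_minus_le f m v' (v 0) Hf Hm Hle); lra. }
  destruct (Rle_lt_dec 0 (w T)) as [HwT | HwT].
  - apply (Hfin phi2 Hphi2 Hm2).
    assert (HA : inv_primitive phi2 (v T) <= inv_primitive phi2 (v 0) + 1 * (T - 0)).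
    { apply inv_primitive_right_derive_le; trivial.
      intros t Ht; destruct (Hvd t Ht) as [l [Hl [Hl1 Hl2]]].
      exists l; split; [exact Hl |].
      assert (0 < phi1 (v t)) by (apply class_P_pos; [exact Hphi1 | apply Hv; lra]).
      assert (0 < phi2 (v t)) by (apply class_P_pos; [exact Hphi2 | apply Hv; lra]).
      destruct (Rle_lt_dec (w t) 0) as [Hw | Hw]; [specialize (Hl1 Hw) |
        specialize (Hl2 ltac:(lra))]; lra. }
    assert (Hpp : 0 < psi2 (v T)) by (apply class_P_pos; assumption).
    specialize (H2 (v T) HvT).
    rewrite <- inv_primitive_minus in H2 by assumption.
    pose proof (inv_primitive_le phi2 v' (psi2 (v T)) Hphi2 ltac:(split; auto)); lra.
  - apply (Hfin phi1 Hphi1 Hm1).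
    assert (HA : inv_primitive phi1 (v T) <= inv_primitive phi1 (v 0) + (-1) * (T - 0)).
    { apply inv_primitive_right_derive_le; trivial.
      intros t Ht; destruct (Hvd t Ht) as [l [Hl [Hl1 _]]].
      exists l; split; [exact Hl |].
      (* If [w] were nonnegative at [t], it would still be so at [T]. *)
      assert (Hw : w t <= 0); [| specialize (Hl1 Hw); lra].
      apply Rnot_lt_le; intros Hw.
      assert (0 <= w T); [| lra].
      apply (nonneg_forward_invariant w t T); try lra.
      - intros s Hs; apply Hwl; lra.
      - intros s Hs; apply Hwd; lra.
      - intros s k Hs; apply Hcross; lra. }
    assert (Hpp : 0 < psi1 (v T)) by (apply class_P_pos; assumption).
    specialize (H1 (v T) HvT).
    rewrite <- inv_primitive_minus in H1 by assumption.
    pose proof (inv_primitive_le phi1 v' (psi1 (v T)) Hphi1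
      ltac:(split; [exact Hv' | apply Hj1; lra])); lra.
Qed.

(** * Comparison functions *)

Lemma continuous_on_comp_maps (T U W : UniformSpace) (D : T -> Prop) (E : U -> Prop)
    (f : T -> U) (g : U -> W) :
  (forall x, D x -> E (f x)) -> continuous_on D f -> continuous_on E g ->
  continuous_on D (fun x => g (f x)).
Proof.
  intros HDE Hf Hg x Hx P HP.
  specialize (Hg (f x) (HDE x Hx) P HP).
  specialize (Hf x Hx _ Hg).
  unfold filtermap, within in *.
  revert Hf; apply filter_imp; auto.
Qed.

Lemma continuous_on_of_continuous (T U : UniformSpace) (D : T -> Prop) (f : T -> U) :
  (forall x, D x -> continuous f x) -> continuous_on D f.
Proof. intros Hf x Hx; eapply filterlim_filter_le_1; [apply filter_le_within | apply Hf, Hx]. Qed.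

Lemma continuous_on_lift2 (T : UniformSpace) (D : T -> Prop) (f h : T -> R)
    (op : R -> R -> R) :
  (forall a b, filterlim (fun p : R * R => op (fst p) (snd p))
     (filter_prod (locally a) (locally b)) (locally (op a b))) ->
  continuous_on D f -> continuous_on D h ->
  continuous_on D (fun x => op (f x) (h x)).
Proof.
  intros Hop Hf Hh x Hx.
  exact (filterlim_comp_2 (G := locally (f x)) (H := locally (h x)) f h op
    (Hf x Hx) (Hh x Hx) (Hop (f x) (h x))).
Qed.

Lemma continuous_on_plus (T : UniformSpace) (D : T -> Prop) (f h : T -> R) :
  continuous_on D f -> continuous_on D h -> continuous_on D (fun x => f x + h x).
Proof.
  apply continuous_on_lift2; intros a b.
  exact (filterlim_plus (V := R_NormedModule) a b).
Qed.

Lemma filterlim_Rmin (a b : R) :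
  filterlim (fun p : R * R => Rmin (fst p) (snd p))
    (filter_prod (locally a) (locally b)) (locally (Rmin a b)).
Proof.
  apply filterlim_locally; intros eps.
  exists (ball a eps) (ball b eps); [apply locally_ball | apply locally_ball |].
  intros x y Hx Hy; simpl.
  change (Rabs (x - a) < eps) in Hx; change (Rabs (y - b) < eps) in Hy.
  change (Rabs (Rmin x y - Rmin a b) < eps).
  apply Rabs_lt_between in Hx; apply Rabs_lt_between in Hy.
  apply Rabs_lt_between; unfold Rmin.
  destruct (Rle_dec x y), (Rle_dec a b); lra.
Qed.

Lemma class_P_Rmin (f h : R -> R) :
  class_P f -> class_P h -> class_P (fun r => Rmin (f r) (h r)).
Proof.
  intros Hf Hh; split; [| split].
  - intros r Hr; apply Rmin_glb; [apply Hf, Hr | apply Hh, Hr].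
  - apply continuous_on_lift2; [apply filterlim_Rmin | apply Hf | apply Hh].
  - intros r Hr; split.
    + intros H; destruct Hr as [Hr | ->]; [| reflexivity].
      pose proof (Rmin_glb_lt _ _ 0 (class_P_pos f r Hf Hr) (class_P_pos h r Hh Hr)); lra.
    + intros ->; rewrite (class_P_0 f), (class_P_0 h) by assumption; apply Rmin_left; lra.
Qed.

Lemma class_K_le (f : R -> R) (a b : R) : class_K f -> 0 <= a <= b -> f a <= f b.
Proof.
  intros [_ H] [Ha [Hab | ->]]; [apply Rlt_le, H; lra | lra].
Qed.

Lemma class_K_nonneg (f : R -> R) (a : R) : class_K f -> 0 <= a -> 0 <= f a.
Proof. intros [[H _] _]; apply H. Qed.

(** The sum [a + b] is at most twice the larger term. This replaces subadditivity and produces the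
    factors [2] in the final bounds. *)
Lemma class_K_weak_triangle (f : R -> R) (a b : R) :
  class_K f -> 0 <= a -> 0 <= b -> f (a + b) <= f (2 * a) + f (2 * b).
Proof.
  intros Hf Ha Hb.
  pose proof (class_K_nonneg f (2 * a) Hf ltac:(lra)).
  pose proof (class_K_nonneg f (2 * b) Hf ltac:(lra)).
  destruct (Rle_lt_dec a b).
  - pose proof (class_K_le f (a + b) (2 * b) Hf ltac:(lra)); lra.
  - pose proof (class_K_le f (a + b) (2 * a) Hf ltac:(lra)); lra.
Qed.

Lemma class_K_intro (f : R -> R) :
  f 0 = 0 -> continuous_on (fun r => 0 <= r) f ->
  (forall r s, 0 <= r -> r < s -> f r < f s) -> class_K f.
Proof.
  intros H0 Hc Hi; split; [| exact Hi].
  assert (Hp : forall r, 0 < r -> 0 < f r).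
  { intros r Hr; rewrite <- H0; apply Hi; lra. }
  split; [| split; [exact Hc |]].
  - intros r [Hr | <-]; [apply Rlt_le, Hp, Hr | lra].
  - intros r [Hr | <-]; [| split; trivial].
    specialize (Hp r Hr); split; lra.
Qed.

Lemma class_K_id : class_K (fun r => r).
Proof.
  apply class_K_intro; [reflexivity | | intros; lra].
  apply continuous_on_of_continuous; intros; apply continuous_id.
Qed.

Lemma class_K_comp (f h : R -> R) :
  class_K f -> class_K h -> class_K (fun r => f (h r)).
Proof.
  intros Hf Hh; apply class_K_intro.
  - rewrite (class_P_0 h (proj1 Hh)); apply (class_P_0 f (proj1 Hf)).
  - apply (continuous_on_comp_maps R_UniformSpace R_UniformSpace R_UniformSpace
      (fun r => 0 <= r) (fun r => 0 <= r)); [| apply Hh | apply Hf].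
    intros r Hr; apply (class_K_nonneg h r Hh Hr).
  - intros r s Hr Hrs; apply (proj2 Hf); [apply (class_K_nonneg h r Hh Hr) |].
    apply (proj2 Hh); assumption.
Qed.

Lemma class_K_plus (f h : R -> R) :
  class_K f -> class_K h -> class_K (fun r => f r + h r).
Proof.
  intros Hf Hh; apply class_K_intro.
  - rewrite (class_P_0 f (proj1 Hf)), (class_P_0 h (proj1 Hh)); ring.
  - apply continuous_on_plus; [apply Hf | apply Hh].
  - intros r s Hr Hrs; pose proof (proj2 Hf r s Hr Hrs); pose proof (proj2 Hh r s Hr Hrs); lra.
Qed.

Lemma class_K_double (f : R -> R) : class_K f -> class_K (fun r => 2 * f r).
Proof.
  intros Hf; apply class_K_intro.
  - rewrite (class_P_0 f (proj1 Hf)); ring.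
  - intros x Hx; eapply filterlim_comp; [apply Hf, Hx |].
    apply (continuous_scal_r (V := R_NormedModule) 2 (fun r => r)); apply continuous_id.
  - intros r s Hr Hrs; pose proof (proj2 Hf r s Hr Hrs); lra.
Qed.

(** The identity supplies the unboundedness; the final gain is obtained in this way. *)
Lemma class_Kinf_id_plus (f : R -> R) : class_K f -> class_Kinf (fun r => r + f r).
Proof.
  intros Hf; split; [apply class_K_plus; [apply class_K_id | exact Hf] |].
  intros M; exists (Rabs M + 1); pose proof (Rabs_pos M); split; [lra |].
  pose proof (class_K_nonneg f (Rabs M + 1) Hf ltac:(lra)); pose proof (Rle_abs M); lra.
Qed.

(** * Inverse functions and the decay flow *)

(** Preimages exist by the intermediate value theorem and are selected by choice. The inverse is
    continuous because [f (h y - eps)] and [f (h y + eps)] bracket [y] strictly. *)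
Lemma increasing_inverse (f : R -> R) :
  (forall x, continuous f x) -> (forall x y, x < y -> f x < f y) ->
  (forall M, exists x, M <= f x) -> (forall M, exists x, f x <= M) ->
  exists h : R -> R, (forall x, h (f x) = x) /\ (forall y, f (h y) = y) /\
    (forall x y, x < y -> h x < h y) /\ (forall y, continuous h y).
Proof.
  intros Hc Hi Hu Hl.
  assert (Hinj : forall x y, f x < f y -> x < y).
  { intros x y H; destruct (Rtotal_order x y) as [H1 | [-> | H1]]; [exact H1 | lra |].
    apply Hi in H1; lra. }
  assert (Hs : forall y, exists x, f x = y).
  { intros y; destruct (Hl y) as [a Ha]; destruct (Hu y) as [b Hb].
    destruct (IVT_gen f a b y) as [x [_ Hx]]; [| | exists x; exact Hx].
    - intros x; apply continuity_pt_filterlim, Hc.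
    - pose proof (Rmin_l (f a) (f b)); pose proof (Rmax_r (f a) (f b)); lra. }
  pose (h := fun y => proj1_sig (constructive_indefinite_description _ (Hs y))).
  assert (Hfh : forall y, f (h y) = y).
  { intros y; unfold h; apply proj2_sig. }
  assert (Hhi : forall x y, x < y -> h x < h y).
  { intros x y H; apply Hinj; rewrite !Hfh; exact H. }
  assert (Hhf : forall x, h (f x) = x).
  { intros x; destruct (Rtotal_order (h (f x)) x) as [H | [H | H]]; [| exact H |];
      apply Hi in H; rewrite Hfh in H; lra. }
  exists h; split; [exact Hhf | split; [exact Hfh | split; [exact Hhi |]]].
  intros y; apply filterlim_locally; intros eps.
  pose proof (cond_pos eps) as Heps.
  assert (H1 : f (h y - eps) < y) by (rewrite <- (Hfh y) at 2; apply Hi; lra).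
  assert (H2 : y < f (h y + eps)) by (rewrite <- (Hfh y) at 1; apply Hi; lra).
  exists (mkposreal (Rmin (y - f (h y - eps)) (f (h y + eps) - y))
    ltac:(apply Rmin_case; lra)).
  intros z Hz.
  change (Rabs (z - y) < Rmin (y - f (h y - eps)) (f (h y + eps) - y)) in Hz.
  pose proof (Rmin_l (y - f (h y - eps)) (f (h y + eps) - y)).
  pose proof (Rmin_r (y - f (h y - eps)) (f (h y + eps) - y)).
  apply Rabs_lt_between in Hz.
  change (Rabs (h z - h y) < eps); apply Rabs_lt_between.
  assert (h y - eps < h z) by (apply Hinj; rewrite Hfh; lra).
  assert (h z < h y + eps) by (apply Hinj; rewrite Hfh; lra).
  lra.
Qed.

(** Serves to turn the lower bound [alpha1 (norm x) <= V x] into a bound on [norm x]. *)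
Lemma class_Kinf_left_inverse (f : R -> R) :
  class_Kinf f -> exists h, class_K h /\ forall r, 0 <= r -> h (f r) = r.
Proof.
  intros [Hf Hu].
  pose proof (class_P_0 f (proj1 Hf)) as Hf0.
  (* [f] extended to a homeomorphism of the line by the identity below [0]. *)
  pose (F := fun r => f (r - Rmin r 0) + Rmin r 0).
  assert (Fpos : forall r, 0 <= r -> F r = f r).
  { intros r Hr; unfold F; rewrite (Rmin_right r 0) by lra.
    rewrite Rminus_0_r; ring. }
  assert (Fneg : forall r, r <= 0 -> F r = r).
  { intros r Hr; unfold F; rewrite (Rmin_left r 0) by lra.
    rewrite Rminus_diag, Hf0; ring. }
  assert (Cmin : continuous_on (fun _ : R => True) (fun r => Rmin r 0)).
  { apply continuous_on_lift2; [apply filterlim_Rmin | |];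
      apply continuous_on_of_continuous; intros; [apply continuous_id | apply continuous_const]. }
  destruct (increasing_inverse F) as [h [H1 [H2 [H3 H4]]]].
  - intros x.
    assert (HF : continuous_on (fun _ : R => True) F).
    { apply continuous_on_plus; [| exact Cmin].
      apply (continuous_on_comp_maps R_UniformSpace R_UniformSpace R_UniformSpace
        (fun _ => True) (fun r => 0 <= r) (fun r => r - Rmin r 0)); [| | apply Hf].
      - intros r _; pose proof (Rmin_l r 0); lra.
      - apply continuous_on_plus.
        + apply continuous_on_of_continuous; intros; apply continuous_id.
        + intros r Hr; eapply filterlim_comp; [exact (Cmin r Hr) |].
          apply (continuous_opp (V := R_NormedModule) (fun r => r)); apply continuous_id. }
    intros P HP; specialize (HF x I P HP).
    unfold filtermap, within in *; revert HF; apply filter_imp; auto.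
  - intros x y Hxy.
    destruct (Rle_lt_dec 0 x) as [Hx | Hx].
    + rewrite !Fpos by lra; apply (proj2 Hf); lra.
    + rewrite (Fneg x) by lra.
      destruct (Rle_lt_dec 0 y) as [Hy | Hy].
      * rewrite (Fpos y) by lra; pose proof (class_K_nonneg f y Hf Hy); lra.
      * rewrite (Fneg y) by lra; lra.
  - intros M; destruct (Hu M) as [r [Hr HM]]; exists r; rewrite Fpos by lra; lra.
  - intros M; exists (Rmin M 0); rewrite Fneg by apply Rmin_r; apply Rmin_l.
  - exists h; split.
    + apply class_K_intro.
      * rewrite <- (Fneg 0) at 1 by lra; apply H1.
      * apply continuous_on_of_continuous; intros; apply H4.
      * intros r s _; apply H3.
    + intros r Hr; rewrite <- (Fpos r Hr); apply H1.
Qed.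

(** The logarithm is the comparison scale for [m <= id]: being unbounded at both ends, it forces the
    same on [inv_primitive m]. *)
Lemma inv_primitive_id (v : R) : 0 < v -> inv_primitive (fun r => r) v = ln v.
Proof.
  intros Hv; unfold inv_primitive.
  apply is_RInt_unique.
  replace (ln v) with (minus (ln v) (ln 1)) by (rewrite ln_1; unfold minus, plus, opp; simpl; ring).
  assert (Hz : forall z, Rmin 1 v <= z -> 0 < z).
  { intros z Hz; pose proof (Rmin_glb_lt 1 v 0 Rlt_0_1 Hv); lra. }
  apply (is_RInt_derive (V := R_CompleteNormedModule) ln (fun s => / s)).
  - intros z [H _]; apply is_derive_Reals, derivable_pt_lim_ln, Hz, H.
  - intros z [H _]; apply continuous_Rinv, Rgt_not_eq, Hz, H.
Qed.

(** Composition with [exp] moves the domain from the positive half line to the whole line, where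
    [increasing_inverse] applies. Increments of [inv_primitive m] dominate those of [ln], whence the
    two unboundedness conditions. *)
Lemma inv_primitive_inverse (m : R -> R) :
  class_P m -> (forall r, 0 < r -> m r <= r) ->
  exists K : R -> R, (forall v, 0 < v -> K (inv_primitive m v) = v) /\
    (forall y, 0 < K y /\ inv_primitive m (K y) = y) /\
    (forall x y, x < y -> K x < K y) /\ (forall y, continuous K y).
Proof.
  intros Hm Hle.
  pose proof (proj1 class_K_id) as Pid.
  assert (H1 : inv_primitive m 1 = 0) by exact (RInt_point (V := R_CompleteNormedModule) 1 _).
  assert (Hln : forall a b, 0 < a <= b ->
    ln b - ln a <= inv_primitive m b - inv_primitive m a).
  { intros a b Hab; rewrite <- !inv_primitive_id by lra.
    apply inv_primitive_minus_le; assumption. }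
  destruct (increasing_inverse (fun u => inv_primitive m (exp u))) as [h [A1 [A2 [A3 A4]]]].
  - intros x; apply (continuous_comp exp (inv_primitive m)).
    + apply (ex_derive_continuous (V := R_NormedModule)); auto_derive; trivial.
    + apply (ex_derive_continuous (V := R_NormedModule)).
      eexists; apply is_derive_inv_primitive; [exact Hm | apply exp_pos].
  - intros x y Hxy; apply inv_primitive_incr; [exact Hm |].
    split; [apply exp_pos | apply exp_increasing, Hxy].
  - intros M; exists (Rabs M).
    assert (1 <= exp (Rabs M)) by (pose proof (exp_ineq1_le (Rabs M)); pose proof (Rabs_pos M); lra).
    pose proof (Hln 1 (exp (Rabs M)) ltac:(lra)) as H2.
    rewrite ln_1, ln_exp, H1 in H2; pose proof (Rle_abs M); lra.
  - intros M; exists (- Rabs M).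
    assert (exp (- Rabs M) <= 1).
    { rewrite <- exp_0; destruct (Rabs_pos M) as [H | <-]; [| rewrite Ropp_0; lra].
      apply Rlt_le, exp_increasing; lra. }
    pose proof (Hln (exp (- Rabs M)) 1 ltac:(pose proof (exp_pos (- Rabs M)); lra)) as H2.
    rewrite ln_1, ln_exp, H1 in H2; pose proof (Rle_abs (- M)); rewrite Rabs_Ropp in *; lra.
  - exists (fun y => exp (h y)); split; [| split; [| split]].
    + intros v Hv; rewrite <- (exp_ln v Hv) at 1; rewrite A1; apply exp_ln, Hv.
    + intros y; split; [apply exp_pos | apply A2].
    + intros x y Hxy; apply exp_increasing, A3, Hxy.
    + intros y; apply (continuous_comp h exp); [apply A4 |].
      apply (ex_derive_continuous (V := R_NormedModule)); auto_derive; trivial.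
Qed.

(* A fundamental solution, in the variables (initial value, time), of the
   scalar equation [y' = - m y]. *)
Record decay_flow (m : R -> R) (b : R -> R -> R) : Prop := {
  decay_continuous : continuous_on (fun p : R * R => 0 <= fst p)
    (fun p : R * R => b (fst p) (snd p));
  decay_class_K : forall t, class_K (fun s => b s t);
  decay_antitone : forall s t t', 0 <= s -> t <= t' -> b s t' <= b s t;
  decay_lim : forall s, 0 <= s -> is_lim (b s) p_infty 0;
  decay_start : forall s, 0 <= s -> b s 0 = s;
  decay_plus : forall s t t', 0 <= s -> b (b s t) t' = b s (t + t');
  decay_le : forall s v t, 0 < s -> 0 < v ->
    inv_primitive m v <= inv_primitive m s - t -> v <= b s t
}.

Lemma decay_flow_exists (m : R -> R) :
  class_P m -> (forall r, 0 < r -> m r <= r) -> exists b, decay_flow m b.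
Proof.
  intros Hm Hle.
  destruct (inv_primitive_inverse m Hm Hle) as [K [K1 [K2 [K3 K4]]]].
  (* In the scale [inv_primitive m] the flow is a translation, defined for all real times. The value
     [0] at [s = 0] is the limit, as [inv_primitive m s] tends to minus infinity there. *)
  pose (b := fun s t => if Rle_dec s 0 then 0 else K (inv_primitive m s - t)).
  assert (b0 : forall t, b 0 t = 0).
  { intros t; unfold b; destruct (Rle_dec 0 0); [reflexivity | lra]. }
  assert (bp : forall s t, 0 < s -> b s t = K (inv_primitive m s - t)).
  { intros s t Hs; unfold b; destruct (Rle_dec s 0); [lra | reflexivity]. }
  assert (Kle : forall x y, x <= y -> K x <= K y).
  { intros x y [H | ->]; [apply Rlt_le, K3, H | lra]. }
  assert (bpos : forall s t, 0 < s -> 0 < b s t).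
  { intros s t Hs; rewrite bp by exact Hs; apply K2. }
  assert (bincr : forall t r s, 0 <= r -> r < s -> b r t < b s t).
  { intros t r s [Hr | <-] Hrs.
    - rewrite !bp by lra; apply K3.
      pose proof (inv_primitive_incr m r s Hm); lra.
    - rewrite b0; apply bpos; lra. }
  assert (banti : forall s t t', 0 <= s -> t <= t' -> b s t' <= b s t).
  { intros s t t' [Hs | <-] Ht; [| rewrite !b0; lra].
    rewrite !bp by lra; apply Kle; lra. }
  assert (bplus : forall s t t', 0 <= s -> b (b s t) t' = b s (t + t')).
  { intros s t t' [Hs | <-]; [| rewrite !b0; reflexivity].
    rewrite (bp (b s t)) by (apply bpos, Hs).
    rewrite !bp by exact Hs.
    rewrite (proj2 (K2 _)); f_equal; ring. }
  assert (bstart : forall s, 0 <= s -> b s 0 = s).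
  { intros s [Hs | <-]; [| apply b0].
    rewrite bp by exact Hs; rewrite Rminus_0_r; apply K1, Hs. }
  assert (bcont : continuous_on (fun p : R * R => 0 <= fst p)
    (fun p : R * R => b (fst p) (snd p))).
  { intros [s t] Hs; simpl in Hs; apply filterlim_locally; intros eps; simpl.
    destruct Hs as [Hs | <-].
    - assert (Hc : continuous (fun p : R * R => K (inv_primitive m (fst p) - snd p)) (s, t)).
      { apply (continuous_comp (fun p : R * R => inv_primitive m (fst p) - snd p) K);
          [| apply K4].
        apply (continuous_minus (V := R_NormedModule) (fun p : R * R => inv_primitive m (fst p)) snd);
          [| apply continuous_snd].
        apply (continuous_comp fst (inv_primitive m)); [apply continuous_fst |].
        apply (ex_derive_continuous (V := R_NormedModule)).
        eexists; apply is_derive_inv_primitive; [exact Hm | exact Hs]. }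
      assert (Hp : locally (s, t) (fun p : R * R => 0 < fst p)).
      { exists (mkposreal s Hs); intros [x y] [Hx _]; simpl in *.
        change (Rabs (x - s) < s) in Hx; apply Rabs_lt_between in Hx; lra. }
      unfold within.
      generalize (filter_and _ _ Hp (proj1 (filterlim_locally _ _) Hc eps)).
      apply filter_imp; intros [x y] [Hx Hy] _; simpl in *.
      rewrite !bp by assumption; exact Hy.
    - (* [b s t' < eps] as soon as [s < b eps (1 - t)] and [t - 1 <= t']. *)
      rewrite b0.
      assert (Hd : 0 < b eps (1 - t)) by (apply bpos, cond_pos).
      exists (mkposreal _ (Rmin_stable_in_posreal (mkposreal _ Hd) (mkposreal 1 Rlt_0_1))).
      intros [x y] [Hx Hy] H0; simpl in *.
      change (Rabs (x - 0) < Rmin (b eps (1 - t)) 1) in Hx.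
      change (Rabs (y - t) < Rmin (b eps (1 - t)) 1) in Hy.
      change (Rabs (b x y - 0) < eps).
      pose proof (Rmin_l (b eps (1 - t)) 1); pose proof (Rmin_r (b eps (1 - t)) 1).
      apply Rabs_lt_between in Hx; apply Rabs_lt_between in Hy.
      assert (E1 : b x y <= b x (t - 1)) by (apply banti; lra).
      assert (E2 : b x (t - 1) < b (b eps (1 - t)) (t - 1)) by (apply bincr; lra).
      rewrite bplus in E2 by (apply Rlt_le, cond_pos).
      replace (1 - t + (t - 1)) with 0 in E2 by ring.
      rewrite bstart in E2 by (apply Rlt_le, cond_pos).
      assert (E3 : 0 <= b x y).
      { destruct H0 as [H0 | <-]; [apply Rlt_le, bpos, H0 | rewrite b0; lra]. }
      apply Rabs_lt_between; lra. }
  exists b; split; trivial.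
  - intros t; apply class_K_intro; [apply b0 | | apply bincr].
    apply (continuous_on_comp_maps R_UniformSpace (prod_UniformSpace R_UniformSpace R_UniformSpace)
      R_UniformSpace (fun s => 0 <= s) (fun p : R * R => 0 <= fst p)
      (fun s => (s, t)) (fun p : R * R => b (fst p) (snd p))); [trivial | | exact bcont].
    apply continuous_on_of_continuous; intros x _ P [eps HP].
    exists eps; intros y Hy; apply HP; split; [exact Hy | apply ball_center].
  - intros s [Hs | <-].
    + apply is_lim_spec; intros eps; simpl.
      (* The time at which the solution started at [s] reaches [eps]. *)
      exists (inv_primitive m s - inv_primitive m eps); intros t Ht.
      rewrite bp by exact Hs.
      pose proof (proj1 (K2 (inv_primitive m s - t))).
      assert (K (inv_primitive m s - t) < K (inv_primitive m eps)) by (apply K3; lra).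
      rewrite K1 in * by apply cond_pos.
      apply Rabs_lt_between; lra.
    + apply is_lim_ext with (fun _ => 0); [intros; symmetry; apply b0 | apply is_lim_const].
  - intros s v t Hs Hv H.
    rewrite bp by exact Hs; rewrite <- (K1 v Hv); apply Kle, H.
Qed.

(** The affine time change will convert elapsed time into accumulated decay. Its values may be
    negative, which is harmless because a decay flow is defined for all real times. *)
Lemma class_KL_decay (m F M : R -> R) (b : R -> R -> R) (c e T : R) :
  decay_flow m b -> class_K F -> class_K M -> 0 < c ->
  class_KL T (fun s t => F (b (M s) (c * t + e))).
Proof.
  intros Hb HF HM Hc.
  assert (HbM : forall s t, 0 <= s -> 0 <= b (M s) t).
  { intros s t Hs; apply (class_K_nonneg _ _ (decay_class_K m b Hb t)).
    apply class_K_nonneg; assumption. }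
  assert (Caff : forall t, continuous (fun t => c * t + e) t).
  { intros t; apply (ex_derive_continuous (V := R_NormedModule)); auto_derive; trivial. }
  assert (Cb : continuous_on (fun p : R * R => 0 <= fst p)
    (fun p : R * R => F (b (M (fst p)) (c * snd p + e)))).
  { apply (continuous_on_comp_maps (prod_UniformSpace R_UniformSpace R_UniformSpace)
      R_UniformSpace R_UniformSpace (fun p : R * R => 0 <= fst p) (fun r => 0 <= r)
      (fun p : R * R => b (M (fst p)) (c * snd p + e)) F); [| | apply HF].
    - intros p Hp; apply HbM, Hp.
    - apply (continuous_on_comp_maps (prod_UniformSpace R_UniformSpace R_UniformSpace)
        (prod_UniformSpace R_UniformSpace R_UniformSpace) R_UniformSpace
        (fun p : R * R => 0 <= fst p) (fun p : R * R => 0 <= fst p)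
        (fun p : R * R => (M (fst p), c * snd p + e))
        (fun p : R * R => b (fst p) (snd p))); [| | apply (decay_continuous m b Hb)].
      + intros p Hp; simpl; apply class_K_nonneg; assumption.
      + intros p Hp P [eps HP].
        assert (L1 : within (fun p : R * R => 0 <= fst p) (locally p)
          (fun q : R * R => ball (M (fst p)) eps (M (fst q)))).
        { apply (continuous_on_comp_maps (prod_UniformSpace R_UniformSpace R_UniformSpace)
            R_UniformSpace R_UniformSpace (fun p : R * R => 0 <= fst p) (fun r => 0 <= r)
            fst M) with (P := ball (M (fst p)) eps); [trivial | | apply HM | exact Hp |].
          - apply continuous_on_of_continuous; intros; apply continuous_fst.
          - apply locally_ball. }
        assert (L2 : locally p (fun q : R * R => ball (c * snd p + e) eps (c * snd q + e))).
        { apply (continuous_comp (snd : R * R -> R) (fun t => c * t + e) p);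
            [apply continuous_snd | apply Caff | apply locally_ball]. }
        unfold within in L1.
        change (locally p (fun q : R * R => 0 <= fst q -> P (M (fst q), c * snd q + e))).
        generalize (filter_and _ _ L1 L2); apply filter_imp.
        intros q [Q1 Q2] Hq; apply HP; split; [apply Q1, Hq | exact Q2]. }
  split; [| split].
  - intros p [Hp _]; specialize (Cb p Hp).
    eapply filterlim_filter_le_1; [| exact Cb].
    intros P; unfold within; apply filter_imp; intros q H [Hq _]; apply H, Hq.
  - intros t _.
    apply (class_K_comp F (fun s => b (M s) (c * t + e)) HF).
    apply (class_K_comp (fun s => b s (c * t + e)) M); [apply (decay_class_K m b Hb) | exact HM].
  - intros s Hs; split; [| split; [| split]].
    + intros t _; apply (class_K_nonneg F _ HF), HbM, Hs.
    + apply (continuous_on_comp_maps R_UniformSpace (prod_UniformSpace R_UniformSpace R_UniformSpace)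
        R_UniformSpace (fun t => T <= t) (fun p : R * R => 0 <= fst p)
        (fun t => (s, t)) (fun p : R * R => F (b (M (fst p)) (c * snd p + e))));
        [intros; exact Hs | | exact Cb].
      apply continuous_on_of_continuous; intros x _ P [eps HP].
      exists eps; intros y Hy; apply HP; split; [apply ball_center | exact Hy].
    + intros t t' _ Htt'; apply (class_K_le F _ _ HF); split; [apply HbM, Hs |].
      apply (decay_antitone m b Hb); [apply (class_K_nonneg M s HM Hs) |].
      pose proof (Rmult_le_compat_l c t t'); lra.
    + apply is_lim_spec; intros eps; simpl.
      assert (HF0 := proj1 (proj2 (proj1 HF)) 0 (Rle_refl 0)).
      rewrite (class_P_0 F (proj1 HF)) in HF0.
      destruct (proj1 (filterlim_locally _ _) HF0 eps) as [eta Heta].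
      pose proof (decay_lim m b Hb (M s) (class_K_nonneg M s HM Hs)) as HL.
      apply is_lim_spec in HL; destruct (HL eta) as [N HN].
      exists ((N - e) / c); intros t Ht.
      apply (Heta (b (M s) (c * t + e))); [| apply HbM, Hs].
      apply HN.
      apply (Rmult_lt_compat_l c) in Ht; [| exact Hc].
      replace (c * ((N - e) / c)) with (N - e) in Ht by (field; lra); lra.
Qed.

(** * Trajectories *)

(** The triangle inequality for [u] and [-u] bounds the norm of [0 u], which is [0], by twice the
    norm of [u]. *)
Lemma sig_norm_nonneg {I : Type} {E : NormedModule R_AbsRing} {U : E -> Prop}
    (S : signal_space I U) (u : I -> E) :
  sig_mem S u -> 0 <= sig_norm S u.
Proof.
  intros Hu; apply sig_mem_lin in Hu.
  pose proof (sig_norm_triangle (s := S) Hu (sig_lin_scal (-1) Hu)) as H.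
  cbv beta in H.
  replace (fun i => plus (u i) (scal (-1) (u i))) with (fun i => scal 0 (u i)) in H.
  - rewrite (sig_norm_scal (s := S) 0 Hu), (sig_norm_scal (s := S) (-1) Hu) in H.
    rewrite Rabs_R0, Rabs_left in H by lra; lra.
  - apply functional_extensionality; intros i.
    pose proof (scal_distr_r (V := E) one (-1) (u i)) as H1.
    rewrite scal_one in H1.
    etransitivity; [| exact H1].
    f_equal; unfold plus, one; simpl; ring.
Qed.

Section Dynamics.

Context {X : CompleteNormedModule R_AbsRing} {E1 E2 : NormedModule R_AbsRing}.
Context {U1 : E1 -> Prop} {U2 : E2 -> Prop}.
Context {S1 : signal_space R U1} {S2 : signal_space nat U2}.
Context {Sc : continuous_dynamics X S1} {g : X -> E2 -> X}.

(* Started anywhere in [a, b], the continuous dynamics survive past [b]; this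
   is what makes the cocycle law and the time shift applicable on [a, b]. *)
Definition alive_on (a b : R) : Prop :=
  forall s x d, a <= s <= b -> sig_mem S1 d -> Rbar_lt (b - s) (lifetime Sc s x d).

Lemma alive_on_defined (a b s t : R) (x : X) (d : R -> E1) :
  alive_on a b -> a <= s -> s <= t <= b -> sig_mem S1 d ->
  defined_at (lifetime Sc) t s x d.
Proof.
  intros Hal Has Ht Hd; split; [lra |].
  eapply Rbar_le_lt_trans; [| apply (Hal s x d); [lra | exact Hd]].
  simpl; lra.
Qed.

Lemma shift_mem (d : R -> E1) (s : R) : sig_mem S1 d -> sig_mem S1 (shift s d).
Proof. apply (proj1 (inputs_admissible Sc)). Qed.

Lemma shift_norm_le (d : R -> E1) (s : R) :
  sig_mem S1 d -> sig_norm S1 (shift s d) <= sig_norm S1 d.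
Proof. apply (proj1 (proj2 (inputs_admissible Sc))). Qed.

Lemma alive_on_defined_shift (a b s t : R) (x : X) (d : R -> E1) :
  alive_on a b -> a <= s -> s <= t <= b -> sig_mem S1 d ->
  defined_at (lifetime Sc) (t - s) 0 x (shift s d).
Proof.
  intros Hal Has Ht Hd.
  destruct (alive_on_defined a b s t x d Hal Has Ht Hd) as [_ H].
  split; [lra |].
  rewrite <- lifetime_shift by exact Hd.
  rewrite Rplus_0_l, Rminus_0_r; exact H.
Qed.

(** Assumption A and the Lie derivatives concern the initial time [0] only; this brings every
    stretch of a trajectory into that form. *)
Lemma flow_to_zero (a b s t : R) (x : X) (d : R -> E1) :
  alive_on a b -> a <= s -> s <= t <= b -> sig_mem S1 d ->
  flow Sc t s x d = flow Sc (t - s) 0 x (shift s d).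
Proof.
  intros Hal Has Ht Hd.
  rewrite <- flow_shift by first [exact Hd | eapply alive_on_defined_shift; eassumption].
  f_equal; ring.
Qed.

Lemma flow_split (a b s t : R) (x : X) (d : R -> E1) :
  alive_on a b -> a <= s -> s <= t <= b -> sig_mem S1 d ->
  flow Sc t a x d = flow Sc t s (flow Sc s a x d) d.
Proof.
  intros Hal Has Ht Hd.
  apply flow_cocycle; trivial; try lra; apply (alive_on_defined a b); trivial; lra.
Qed.

Lemma flow_norm_le (a b s t tau : R) (x : X) (d : R -> E1) (xi eta : R -> R) :
  (forall t x d1, sig_mem S1 d1 -> 0 <= t <= tau -> defined_at (lifetime Sc) t 0 x d1 ->
     norm (flow Sc t 0 x d1) <= xi (norm x) + eta (sig_norm S1 d1)) ->
  class_K eta ->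
  alive_on a b -> a <= s -> s <= t <= b -> t - s <= tau -> sig_mem S1 d ->
  norm (flow Sc t s x d) <= xi (norm x) + eta (sig_norm S1 d).
Proof.
  intros HA Heta Hal Has Ht Htau Hd.
  rewrite (flow_to_zero a b) by trivial.
  pose proof (shift_mem d s Hd) as Hsd.
  eapply Rle_trans; [apply HA; [exact Hsd | lra |
    eapply alive_on_defined_shift; eassumption] |].
  apply Rplus_le_compat_l, (class_K_le eta); [exact Heta |].
  split; [apply sig_norm_nonneg, Hsd | apply shift_norm_le, Hd].
Qed.

Lemma flow_left_limit (a b t : R) (z : X) (d : R -> E1) (F : X -> R) :
  alive_on a b -> a < t <= b -> sig_mem S1 d -> (forall x, continuous F x) ->
  filterlim (fun s => F (flow Sc s a z d)) (at_left t) (locally (F (flow Sc t a z d))).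
Proof.
  intros Hal Ht Hd HF.
  eapply filterlim_filter_le_1; [apply filter_le_within |].
  apply (continuous_comp (fun s => flow Sc s a z d) F); [| apply HF].
  apply flow_continuous; [exact Hd | lra |].
  apply (alive_on_defined a b a t z d); trivial; lra.
Qed.

(** By the cocycle law the trajectory after [t] restarts at its current state, and by the time shift
    this restart may take place at time [0] with the shifted input. *)
Lemma flow_right_derive (a b t l : R) (z : X) (d : R -> E1) (F : X -> R) :
  alive_on a b -> a <= t < b -> sig_mem S1 d ->
  (is_right_derive (fun s => F (flow Sc s a z d)) t l <->
   is_lie_derivative Sc F (flow Sc t a z d) (shift t d) l).
Proof.
  intros Hal Ht Hd.
  assert (Heq : at_right 0 (fun h =>
    / h * (F (flow Sc (t + h) a z d) - F (flow Sc t a z d)) =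
    / h * (F (flow Sc h 0 (flow Sc t a z d) (shift t d)) - F (flow Sc t a z d)))).
  { exists (mkposreal (b - t) ltac:(lra)); intros h Hh H0.
    change (Rabs (h - 0) < b - t) in Hh; apply Rabs_lt_between in Hh.
    rewrite (flow_split a b t (t + h)), (flow_to_zero a b t (t + h)) by (trivial; lra).
    rewrite Rplus_minus_l; reflexivity. }
  split; intros H; unfold is_right_derive, is_lie_derivative in *.
  - eapply filterlim_ext_loc; [exact Heq | exact H].
  - eapply filterlim_ext_loc; [| exact H].
    revert Heq; apply filter_imp; intros; symmetry; assumption.
Qed.

(** * Impulse times *)

Context {tau : nat -> R} {phi : R -> R -> X -> (R -> E1) -> (nat -> E2) -> X}.
Hypothesis hS : impulsive_system S2 Sc g tau phi.

Lemma impulses_le (j k : nat) : (j <= k)%nat -> tau j <= tau k.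
Proof.
  induction 1 as [| k _ IH]; [lra |].
  pose proof (impulses_incr hS k); lra.
Qed.

Lemma first_impulse_exists (t : R) : exists p, first_impulse tau t p.
Proof.
  assert (H : exists n, t <= tau n).
  { destruct (proj2 (is_lim_seq_spec _ _) (impulses_lim hS) t) as [N HN].
    exists N; apply Rlt_le, HN, Nat.le_refl. }
  destruct H as [n Hn]; revert Hn.
  induction n as [n IH] using Wf_nat.lt_wf_ind; intros Hn.
  destruct (classic (exists j, (j < n)%nat /\ t <= tau j)) as [[j [Hj Htj]] | Hno].
  - apply (IH j Hj Htj).
  - exists n; split; [exact Hn |].
    intros j Hj; apply Rnot_le_lt; intros H; apply Hno; exists j; split; assumption.
Qed.

Lemma alive_on_first (t0 : R) (p : nat) : first_impulse tau t0 p -> alive_on t0 (tau p).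
Proof.
  intros [Hp Hlt] s x d Hs Hd.
  apply (life_first hS); [exact Hd |].
  split; [lra | intros j Hj; specialize (Hlt j Hj); lra].
Qed.

(** For a start strictly after [tau k] the first impulse is number [S k], so [life_first] applies; a
    start at [tau k] itself is covered by [life_next]. *)
Lemma alive_on_next (k : nat) : alive_on (tau k) (tau (S k)).
Proof.
  intros s x d [[Hs | <-] Hs'] Hd; [| apply (life_next hS), Hd].
  apply (life_first hS); [exact Hd |].
  split; [exact Hs' |].
  intros j Hj; pose proof (impulses_le j k ltac:(lia)); lra.
Qed.

Lemma impulse_interval (t t0 : R) (p : nat) :
  first_impulse tau t0 p -> tau p < t ->
  exists k, tau (p + k) < t <= tau (S (p + k)).
Proof.
  intros Hp Ht.
  destruct (first_impulse_exists t) as [q [Hq1 Hq2]].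
  assert (Hpq : (p < q)%nat).
  { apply Nat.nle_gt; intros H; apply impulses_le in H; lra. }
  exists (q - p - 1)%nat.
  replace (p + (q - p - 1))%nat with (q - 1)%nat by lia.
  replace (S (q - 1)) with q by lia.
  split; [apply Hq2; lia | exact Hq1].
Qed.

(** Impulses cannot be too rare; this bounds their number from below in terms of the elapsed
    time. *)
Lemma impulses_spread (theta2 : R) (p k : nat) :
  (forall k, tau (S k) - tau k <= theta2) -> tau (p + k) <= tau p + INR k * theta2.
Proof.
  intros H; induction k as [| k IH].
  - rewrite Nat.add_0_r; simpl; lra.
  - rewrite Nat.add_succ_r, S_INR; specialize (H (p + k)%nat); lra.
Qed.

(** * Estimates from the Lyapunov function *)

Section Lyapunov.

Context {V W : X -> R} {chi phi1 phi2 psi1 psi2 : R -> R}.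
Hypothesis hV : ISS_Lyapunov U2 Sc g V W chi phi1 phi2 psi1 psi2.
Context {theta1 theta2 delta : R}.
Hypothesis hdelta : 0 < delta.
Hypothesis h1 : forall a, 0 < a -> RInt (fun s => / phi1 s) a (psi1 a) <= theta1 - delta.
Hypothesis h2 : forall a, 0 < a -> theta2 + delta <= RInt (fun s => / phi2 s) (psi2 a) a.
Hypothesis hT : forall k, theta1 <= tau (S k) - tau k <= theta2.

Lemma lyap_V_pos (x : X) : 0 < norm x -> 0 < V x.
Proof.
  intros Hx; destruct (lyap_V_bounds hV) as [a1 [a2 [Ha1 [_ H]]]].
  pose proof (class_P_pos a1 (norm x) (proj1 (proj1 Ha1)) Hx); specialize (H x); lra.
Qed.

(** An instance of [hybrid_step] with time counted from [tau k]. Staying strictly outside the ball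
    makes every Lyapunov implication available and keeps the state away from zero. The premise
    [0 < V z'] places the new value in the domain of [inv_primitive]. *)
Lemma jump_to_jump_decrease (m : R -> R) (k : nat) (z : X) (d1 : R -> E1) (mu : E2) (D : R) :
  class_P m -> (forall r, 0 < r -> m r <= phi1 r) -> (forall r, 0 < r -> m r <= phi2 r) ->
  sig_mem S1 d1 -> U2 mu -> sig_norm S1 d1 <= D -> norm mu <= D ->
  (forall s, tau k <= s <= tau (S k) -> chi D < norm (flow Sc s (tau k) z d1)) ->
  let z' := g (flow Sc (tau (S k)) (tau k) z d1) mu in
  0 < V z' -> inv_primitive m (V z') <= inv_primitive m (V z) - delta.
Proof.
  intros Hm Hm1 Hm2 Hd Hmu HdD HmuD Hfar z' Hz'.
  pose proof (impulses_incr hS k) as Hk.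
  pose proof (alive_on_next k) as Hal.
  pose proof (lyap_chi hV) as [Hchi _].
  assert (HD : 0 <= D) by (pose proof (sig_norm_nonneg _ _ Hd); lra).
  pose (T := tau (S k) - tau k).
  pose (x := fun s => flow Sc (tau k + s) (tau k) z d1).
  assert (Hfar' : forall s, 0 <= s <= T -> chi D < norm (x s)).
  { intros s Hs; apply Hfar; unfold T in Hs; lra. }
  (* Stated for every [d] of norm at most [D], since the Lie derivative at time [s] involves the
     shifted input instead of [d1]. *)
  assert (Hmax : forall s d, 0 <= s <= T -> sig_mem S1 d -> sig_norm S1 d <= D ->
    Rmax (chi (sig_norm S1 d)) (chi (norm mu)) <= norm (x s)).
  { intros s d Hs Hmd Hnd; specialize (Hfar' s Hs).
    apply Rmax_lub.
    - pose proof (class_K_le chi (sig_norm S1 d) D Hchi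
        (conj (sig_norm_nonneg _ _ Hmd) Hnd)); lra.
    - pose proof (class_K_le chi (norm mu) D Hchi (conj (norm_ge_0 mu) HmuD)); lra. }
  assert (Hnz : forall s, 0 <= s <= T -> 0 < norm (x s)).
  { intros s Hs; specialize (Hfar' s Hs).
    pose proof (class_K_nonneg chi D Hchi HD); lra. }
  assert (HxT : x T = flow Sc (tau (S k)) (tau k) z d1).
  { unfold x, T; f_equal; ring. }
  assert (Hx0 : x 0 = z).
  { unfold x; rewrite Rplus_0_r; apply flow_id, Hd. }
  assert (Hleft : forall F : X -> R, (forall y, continuous F y) -> forall t, 0 < t <= T ->
    filterlim (fun s => F (x s)) (at_left t) (locally (F (x t)))).
  { intros F HF t Ht.
    apply (filterlim_comp _ _ _ (fun s => tau k + s) (fun s => F (flow Sc s (tau k) z d1))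
      _ (at_left (tau k + t))).
    - intros P [eps HP]; exists eps; intros y Hy Hyt; apply HP; [| lra].
      change (Rabs (tau k + y - (tau k + t)) < eps).
      change (Rabs (y - t) < eps) in Hy.
      replace (tau k + y - (tau k + t)) with (y - t) by ring; exact Hy.
    - apply (flow_left_limit _ (tau (S k))); trivial; unfold T in Ht; lra. }
  assert (Hder : forall (F : X -> R) l t, 0 <= t < T ->
    (is_right_derive (fun s => F (x s)) t l <->
     is_lie_derivative Sc F (x t) (shift (tau k + t) d1) l)).
  { intros F l t Ht.
    unfold x; rewrite <- (flow_right_derive (tau k) (tau (S k)) (tau k + t) l z d1 F)
      by (trivial; unfold T in Ht; lra).
    unfold is_right_derive.
    split; apply filterlim_ext; intros h; rewrite Rplus_assoc; reflexivity. }
  rewrite <- Hx0.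
  apply (hybrid_step phi1 phi2 psi1 psi2 m (fun s => V (x s)) (fun s => W (x s))
    theta1 theta2 delta T (V z'));
    trivial; try (apply hV).
  - unfold T; lra.
  - apply hT.
  - intros t Ht; apply lyap_V_pos, Hnz, Ht.
  - apply Hleft, (lyap_V_continuous hV).
  - apply Hleft, (lyap_W_continuous hV).
  - intros t Ht.
    pose proof (shift_mem d1 (tau k + t) Hd) as Hs.
    pose proof (shift_norm_le d1 (tau k + t) Hd) as Hn.
    destruct (lyap_V_diff hV (x t) Hs) as [l Hl].
    assert (Hmt := Hmax t _ ltac:(lra) Hs ltac:(lra)).
    exists l; split; [apply Hder; assumption | split; intros Hw].
    + apply (lyap_Gminus hV Hs Hmu Hw Hmt), Hl.
    + apply (lyap_Gplus hV Hs Hmu Hw Hmt), Hl.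
  - intros t Ht.
    destruct (lyap_W_diff hV (x t) (shift_mem d1 (tau k + t) Hd)) as [l Hl].
    exists l; apply Hder; assumption.
  - intros t l Ht Hw Hl.
    pose proof (shift_mem d1 (tau k + t) Hd) as Hs.
    pose proof (shift_norm_le d1 (tau k + t) Hd) as Hn.
    apply (lyap_W_crossing hV Hs Hw).
    + intros H0; specialize (Hnz t ltac:(lra)); rewrite H0 in Hnz; exact (Rlt_not_eq _ _ Hnz (eq_sym norm_zero)).
    + pose proof (Hmax t _ ltac:(lra) Hs ltac:(lra)).
      pose proof (Rmax_l (chi (sig_norm S1 (shift (tau k + t) d1))) (chi (norm mu))); lra.
    + apply Hder; assumption.
  (* Only the jump estimate is taken here; any admissible signal of norm at most [D] may accompany
     [mu], and [d1] serves. *)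
  - intros Hw; unfold z'; rewrite <- HxT.
    apply (lyap_Gminus hV Hd Hmu Hw), Hmax; trivial; unfold T; lra.
  - intros Hw; unfold z'; rewrite <- HxT.
    apply (lyap_Gplus hV Hd Hmu Hw), Hmax; trivial; unfold T; lra.
Qed.

Section Bounds.

Context {m : R -> R} {b : R -> R -> R} {xi2 eta2 xi eta a2 : R -> R}.
Hypothesis Hm : class_P m.
Hypothesis Hm1 : forall r, 0 < r -> m r <= phi1 r.
Hypothesis Hm2 : forall r, 0 < r -> m r <= phi2 r.
Hypothesis Hb : decay_flow m b.
Hypotheses (Kxi2 : class_K xi2) (Keta2 : class_K eta2).
Hypotheses (Kxi : class_K xi) (Keta : class_K eta) (Ka2 : class_K a2).
Hypothesis Hflow : forall t x d1, sig_mem S1 d1 -> 0 <= t <= theta2 ->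
  defined_at (lifetime Sc) t 0 x d1 ->
  norm (flow Sc t 0 x d1) <= xi2 (norm x) + eta2 (sig_norm S1 d1).
Hypothesis Hjump : forall x d2 k, sig_mem S2 d2 ->
  norm (g x (d2 k)) <= xi (norm x) + eta (sig_norm S2 d2).
Hypothesis Ha2 : forall x, V x <= a2 (norm x).

(** Read from the inside: a state in the ball of radius [chi D] flows for a time at most [theta2],
    then jumps, and then [V] is estimated by [a2]. *)
Definition reentry_bound (D : R) : R := a2 (xi (xi2 (chi D) + eta2 D) + eta D).

Lemma class_K_reentry_bound : class_K reentry_bound.
Proof.
  pose proof (proj1 (lyap_chi hV)) as Hchi.
  apply (class_K_comp a2); [exact Ka2 |].
  apply class_K_plus; [| exact Keta].
  apply (class_K_comp xi); [exact Kxi |].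
  apply class_K_plus; [apply class_K_comp; assumption | exact Keta2].
Qed.

Lemma jump_to_jump_bound (k j : nat) (z : X) (d1 : R -> E1) (d2 : nat -> E2) (D : R) :
  sig_mem S1 d1 -> sig_mem S2 d2 -> sig_norm S1 d1 <= D -> sig_norm S2 d2 <= D ->
  V (g (flow Sc (tau (S k)) (tau k) z d1) (d2 j)) <= Rmax (b (V z) delta) (reentry_bound D).
Proof.
  intros Hd1 Hd2 HD1 HD2.
  pose proof (impulses_incr hS k) as Hk.
  pose proof (proj1 (lyap_chi hV)) as Hchi.
  pose proof (sig_norm_nonneg _ _ Hd1) as Hn1.
  pose proof (sig_norm_nonneg _ _ Hd2) as Hn2.
  pose proof (jump_input_bound hS j Hd2) as Hn2j.
  set (x := flow Sc (tau (S k)) (tau k) z d1).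
  destruct (classic (exists s, tau k <= s <= tau (S k) /\
    norm (flow Sc s (tau k) z d1) <= chi D)) as [[s [Hs Hsm]] | Hfar].
  - eapply Rle_trans; [| apply Rmax_r].
    assert (Hx : norm x <= xi2 (chi D) + eta2 D).
    { unfold x.
      rewrite (flow_split (tau k) (tau (S k)) s (tau (S k)))
        by (first [apply alive_on_next | exact Hd1 | lra]).
      eapply Rle_trans.
      - apply (flow_norm_le (tau k) (tau (S k)) s (tau (S k)) theta2 _ d1 xi2 eta2);
          trivial; try lra; [apply alive_on_next | pose proof (hT k); lra].
      - pose proof (class_K_le xi2 _ _ Kxi2 (conj (norm_ge_0 _) Hsm)).
        pose proof (class_K_le eta2 _ _ Keta2 (conj Hn1 HD1)); lra. }
    eapply Rle_trans; [apply Ha2 |].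
    apply (class_K_le a2 _ _ Ka2); split; [apply norm_ge_0 |].
    eapply Rle_trans; [apply Hjump, Hd2 |].
    pose proof (class_K_le xi _ _ Kxi (conj (norm_ge_0 _) Hx)).
    pose proof (class_K_le eta _ _ Keta (conj Hn2 HD2)); lra.
  - eapply Rle_trans; [| apply Rmax_l].
    assert (Hfar' : forall s, tau k <= s <= tau (S k) ->
      chi D < norm (flow Sc s (tau k) z d1)).
    { intros s Hs; apply Rnot_le_lt; intros H; apply Hfar; exists s; split; assumption. }
    assert (Hz : 0 < V z).
    { apply lyap_V_pos.
      specialize (Hfar' (tau k) ltac:(lra)); rewrite flow_id in Hfar' by exact Hd1.
      pose proof (class_K_nonneg chi D Hchi ltac:(lra)); lra. }
    (* A vanishing value of [V] after the jump is outside the scope of [inv_primitive]; there the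
       nonnegativity of [b] suffices. *)
    destruct (lyap_V_nonneg hV (g x (d2 j))) as [H | H].
    + apply (decay_le m b Hb); trivial.
      apply (jump_to_jump_decrease m k z d1 (d2 j) D); trivial;
        [apply (sig_mem_val Hd2) | lra].
    + rewrite <- H; apply (class_K_nonneg _ _ (decay_class_K m b Hb delta)); lra.
Qed.

(** The maximum survives iteration of [jump_to_jump_bound]: [b] is monotone in its first argument,
    the decaying term follows the semigroup law, and [b] does not enlarge [reentry_bound D]. *)
Lemma post_jump_bound (t0 : R) (x : X) (d1 : R -> E1) (d2 : nat -> E2) (D : R) (p k : nat) :
  sig_mem S1 d1 -> sig_mem S2 d2 -> sig_norm S1 d1 <= D -> sig_norm S2 d2 <= D ->
  first_impulse tau t0 p ->
  V (g (phi (tau (p + k)) t0 x d1 d2) (d2 (p + k)%nat)) <=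
    Rmax (b (V (g (phi (tau p) t0 x d1 d2) (d2 p))) (INR k * delta)) (reentry_bound D).
Proof.
  intros Hd1 Hd2 HD1 HD2 Hp.
  pose proof (sig_norm_nonneg _ _ Hd1) as Hn1.
  pose proof (class_K_nonneg _ D class_K_reentry_bound ltac:(lra)) as HC.
  pose proof (lyap_V_nonneg hV) as HVn.
  induction k as [| k IH].
  - rewrite Nat.add_0_r; simpl; rewrite Rmult_0_l, (decay_start m b Hb) by apply HVn.
    apply Rmax_l.
  - rewrite Nat.add_succ_r.
    set (z := g (phi (tau (p + k)) t0 x d1 d2) (d2 (p + k)%nat)) in *.
    set (v0 := V (g (phi (tau p) t0 x d1 d2) (d2 p))) in *.
    rewrite (traj_next hS (t := tau (S (p + k))) x Hd1 Hd2 Hp (k := (p + k)%nat))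
      by (first [lia | pose proof (impulses_incr hS (p + k)); lra]).
    fold z.
    eapply Rle_trans; [apply (jump_to_jump_bound _ _ _ _ _ D); assumption |].
    apply Rmax_lub; [| apply Rmax_r].
    eapply Rle_trans;
      [exact (class_K_le _ _ _ (decay_class_K m b Hb delta) (conj (HVn z) IH)) |].
    unfold Rmax at 1; destruct (Rle_dec (b v0 (INR k * delta)) (reentry_bound D)).
    + eapply Rle_trans; [| apply Rmax_r].
      rewrite <- (decay_start m b Hb (reentry_bound D) HC) at 2.
      apply (decay_antitone m b Hb); lra.
    + eapply Rle_trans; [| apply Rmax_l].
      rewrite (decay_plus m b Hb) by apply HVn.
      right; f_equal; rewrite S_INR; ring.
Qed.

End Bounds.

End Lyapunov.

End Dynamics.

(** * Assembly of the bound for an arbitrary initial time *)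

Theorem theorem1
  (X : CompleteNormedModule R_AbsRing) (E1 E2 : NormedModule R_AbsRing)
  (U1 : E1 -> Prop) (U2 : E2 -> Prop)
  (S1 : signal_space R U1) (S2 : signal_space nat U2)
  (Sc : continuous_dynamics X S1) (g : X -> E2 -> X)
  (hA : assumption_A S2 Sc g)
  (V W : X -> R) (chi phi1 phi2 psi1 psi2 : R -> R)
  (hV : ISS_Lyapunov U2 Sc g V W chi phi1 phi2 psi1 psi2)
  (theta1 theta2 delta : R) (htheta : theta1 <= theta2) (hdelta : 0 < delta)
  (h1 : forall a, 0 < a ->
     RInt (fun s => / phi1 s) a (psi1 a) <= theta1 - delta)
  (h2 : forall a, 0 < a ->
     theta2 + delta <= RInt (fun s => / phi2 s) (psi2 a) a)
  (tau : nat -> R) (phi : R -> R -> X -> (R -> E1) -> (nat -> E2) -> X)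
  (hS : impulsive_system S2 Sc g tau phi)
  (hT : forall k, theta1 <= tau (S k) - tau k <= theta2) :
  ISS S1 S2 phi.
Proof.
  intros t0.
  destruct (first_impulse_exists hS t0) as [p Hp].
  assert (Hth : 0 < theta2).
  { pose proof (impulses_incr hS 0); pose proof (hT 0%nat); lra. }
  destruct hA as [HA [xi [eta [[Kxi _] [[Keta _] Hjump]]]]].
  destruct (HA theta2) as [xi2 [eta2 [[Kxi2 _] [[Keta2 _] Hflow2]]]]; [lra |].
  (* The stretch before the first impulse may be longer than [theta2] and has its own bounds;
     through them and through [p] the result depends on [t0]. *)
  destruct (HA (tau p - t0)) as [xi0 [eta0 [[Kxi0 _] [[Keta0 _] Hflow0]]]];
    [destruct Hp; lra |].
  destruct (lyap_V_bounds hV) as [a1 [a2 [Ka1 [[Ka2 _] Ha]]]].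
  destruct (class_Kinf_left_inverse a1 Ka1) as [a1i [Ka1i Ha1i]].
  pose proof (lyap_V_nonneg hV) as HVn.
  pose (m := fun r => Rmin (Rmin (phi1 r) (phi2 r)) r).
  assert (Hm : class_P m).
  { apply class_P_Rmin; [| apply class_K_id].
    apply class_P_Rmin; [apply (lyap_phi1 hV) | apply (lyap_phi2 hV)]. }
  assert (Hmle : forall r, m r <= phi1 r /\ m r <= phi2 r /\ m r <= r).
  { intros r; unfold m.
    pose proof (Rmin_l (Rmin (phi1 r) (phi2 r)) r); pose proof (Rmin_r (Rmin (phi1 r) (phi2 r)) r).
    pose proof (Rmin_l (phi1 r) (phi2 r)); pose proof (Rmin_r (phi1 r) (phi2 r)); lra. }
  destruct (decay_flow_exists m Hm) as [b Hb]; [intros; apply Hmle |].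
  pose (C := @reentry_bound chi xi2 eta2 xi eta a2).
  assert (KC : class_K C) by (unfold C; eapply class_K_reentry_bound; eassumption).
  (* The state after the first jump has norm at most [A (norm x) + B D]; likewise [A2] and [B2]
     below bound its value of [V]. *)
  pose (A := fun s => xi (2 * xi0 s)).
  pose (B := fun D => xi (2 * eta0 D) + eta D).
  assert (KA : class_K A).
  { apply (class_K_comp xi (fun s => 2 * xi0 s)), class_K_double; assumption. }
  assert (KB : class_K B).
  { apply class_K_plus; [| exact Keta].
    apply (class_K_comp xi (fun s => 2 * eta0 s)), class_K_double; assumption. }
  pose (A2 := fun s => a2 (2 * A s)).
  pose (B2 := fun D => a2 (2 * B D)).
  assert (KA2 : class_K A2).
  { apply (class_K_comp a2 (fun s => 2 * A s)), class_K_double; assumption. }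
  assert (KB2 : class_K B2).
  { apply (class_K_comp a2 (fun s => 2 * B s)), class_K_double; assumption. }
  (* One majorant for two purposes: [xi0] for the initial stretch, [2 * A2] for the share of [x] in
     the first value of [V] after a jump. *)
  pose (M := fun s => xi0 s + 2 * A2 s).
  assert (KM : class_K M) by (apply class_K_plus; [| apply class_K_double]; assumption).
  (* The identity serves the initial stretch; the other term passes from [V] back to the norm and
     then through the flow following a jump. *)
  pose (F := fun r => r + xi2 (2 * a1i (2 * r))).
  assert (KF : forall f, class_K f -> class_K (fun r => xi2 (2 * a1i (2 * f r)))).
  { intros f Hf.
    apply (class_K_comp xi2 (fun r => 2 * a1i (2 * f r))), class_K_double; trivial.
    apply (class_K_comp a1i (fun r => 2 * f r)), class_K_double; trivial. }
  pose (c := delta / theta2).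
  assert (Hc : 0 < c) by (apply Rdiv_lt_0_compat; assumption).
  (* Thus [c * t + e = c * (t - tau p) - delta]: each time [theta2] is worth a decay [delta], and
     one [delta] is given up for the current, unfinished period. *)
  pose (e := - c * tau p - delta).
  pose (G := fun D => C D + 2 * B2 D).
  assert (KG : class_K G) by (apply class_K_plus; [| apply class_K_double]; assumption).
  exists (fun s t => F (b (M s) (c * t + e))).
  exists (fun D => D + (eta0 D + (eta2 D + xi2 (2 * a1i (2 * G D))))).
  split; [| split].
  - apply (class_KL_decay m F M b c e); trivial.
    apply class_K_plus; [apply class_K_id | apply (KF (fun r => r)), class_K_id].
  - apply class_Kinf_id_plus.
    repeat (apply class_K_plus; [assumption |]); apply (KF G KG).
  - intros t x d1 d2 Ht Hd1 Hd2.
    set (D := Rmax (sig_norm S1 d1) (sig_norm S2 d2)).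
    assert (HD1 : 0 <= sig_norm S1 d1 <= D)
      by (split; [apply sig_norm_nonneg, Hd1 | apply Rmax_l]).
    assert (HD2 : 0 <= sig_norm S2 d2 <= D)
      by (split; [apply sig_norm_nonneg, Hd2 | apply Rmax_r]).
    pose proof (norm_ge_0 x) as Hx.
    pose proof (class_K_nonneg xi0 _ Kxi0 Hx) as Hxi0.
    pose proof (class_K_nonneg A2 _ KA2 Hx) as HA2.
    pose proof (class_K_nonneg eta0 D Keta0 ltac:(lra)) as Heta0.
    pose proof (class_K_nonneg eta2 D Keta2 ltac:(lra)) as Heta2.
    pose proof (class_K_nonneg _ D (KF G KG) ltac:(lra)) as HGp.
    pose proof (class_K_nonneg G D KG ltac:(lra)) as HG.
    pose proof (class_K_nonneg B2 D KB2 ltac:(lra)) as HB2.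
    pose proof (class_K_nonneg C D KC ltac:(lra)) as HCn.
    assert (HM : 0 <= M (norm x)) by (unfold M; lra).
    pose proof (decay_class_K m b Hb) as Kb.
    set (bt := b (M (norm x)) (c * t + e)).
    assert (Hbt : 0 <= bt) by (apply (class_K_nonneg _ _ (Kb _)), HM).
    pose proof (class_K_nonneg _ bt (KF (fun r => r) class_K_id) Hbt) as HFb.
    assert (Hfirst : forall s, t0 <= s <= tau p ->
      norm (phi s t0 x d1 d2) <= xi0 (norm x) + eta0 D).
    { intros s Hs.
      rewrite (traj_first hS x Hd1 Hd2 Hp Hs).
      eapply Rle_trans.
      - apply (flow_norm_le t0 (tau p) t0 s (tau p - t0) x d1 xi0 eta0); trivial; try lra.
        eapply alive_on_first; eassumption.
      - pose proof (class_K_le eta0 _ _ Keta0 HD1); lra. }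
    destruct (Rle_lt_dec t (tau p)) as [Htp | Htp].
    + specialize (Hfirst t ltac:(lra)).
      (* Up to the first impulse the time argument of [b] is negative, so [b] is at least its
         initial value. *)
      assert (M (norm x) <= bt).
      { rewrite <- (decay_start m b Hb (M (norm x)) HM) at 1.
        apply (decay_antitone m b Hb); [exact HM |].
        pose proof (Rmult_le_compat_l c t (tau p)); unfold e; lra. }
      unfold F, M in *; lra.
    + destruct (impulse_interval hS t t0 p Hp Htp) as [k Hk].
      set (z0 := g (phi (tau p) t0 x d1 d2) (d2 p)).
      set (z := g (phi (tau (p + k)%nat) t0 x d1 d2) (d2 (p + k)%nat)).
      assert (Hz0 : norm z0 <= A (norm x) + B D).
      { eapply Rle_trans; [apply Hjump, Hd2 |].
        pose proof (class_K_le eta _ _ Keta HD2).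
        pose proof (Hfirst (tau p) ltac:(destruct Hp; lra)) as Hfp.
        pose proof (class_K_le xi _ _ Kxi (conj (norm_ge_0 _) Hfp)).
        pose proof (class_K_weak_triangle xi _ _ Kxi Hxi0 Heta0).
        unfold A, B; lra. }
      assert (HV0 : V z0 <= A2 (norm x) + B2 D).
      { pose proof (proj2 (Ha z0)).
        pose proof (class_K_le a2 _ _ Ka2 (conj (norm_ge_0 _) Hz0)).
        pose proof (class_K_weak_triangle a2 _ _ Ka2 (class_K_nonneg A _ KA Hx)
          (class_K_nonneg B D KB ltac:(lra))).
        unfold A2, B2; lra. }
      (* The interval from [tau p] to [t] is covered by [k + 1] periods of length at most
         [theta2]. *)
      assert (Hkt : c * t + e <= INR k * delta).
      { pose proof (impulses_spread theta2 p (S k) (fun j => proj2 (hT j))) as H.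
        rewrite Nat.add_succ_r, S_INR in H.
        assert (H' : c * (t - tau p) <= c * ((INR k + 1) * theta2))
          by (apply Rmult_le_compat_l; lra).
        replace (c * ((INR k + 1) * theta2)) with (INR k * delta + delta) in H'
          by (unfold c; field; lra).
        unfold e; lra. }
      assert (Hkd : 0 <= INR k * delta) by (apply Rmult_le_pos; [apply pos_INR | lra]).
      assert (HVz : V z <= bt + G D).
      { eapply Rle_trans.
        - apply (post_jump_bound hS hV hdelta h1 h2 hT Hm
            (fun r _ => proj1 (Hmle r)) (fun r _ => proj1 (proj2 (Hmle r)))
            Hb Kxi2 Keta2 Kxi Keta Ka2 Hflow2 Hjump (fun y => proj2 (Ha y))
            t0 x d1 d2 D p k Hd1 Hd2 (proj2 HD1) (proj2 HD2) Hp).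
        - apply Rmax_lub; [| unfold G, C in *; lra].
          eapply Rle_trans.
          + exact (class_K_le _ _ _ (Kb (INR k * delta)) (conj (HVn z0) HV0)).
          (* The share of the initial state keeps its decay and is absorbed in [bt]; that of the
             input is bounded by its value at time [0] and goes into [G]. *)
          + eapply Rle_trans; [apply (class_K_weak_triangle _ _ _ (Kb _)); assumption |].
            assert (b (2 * A2 (norm x)) (INR k * delta) <= bt).
            { eapply Rle_trans; [apply (decay_antitone m b Hb _ (c * t + e)); lra |].
              apply (class_K_le _ _ _ (Kb _)); unfold M; lra. }
            assert (b (2 * B2 D) (INR k * delta) <= 2 * B2 D).
            { rewrite <- (decay_start m b Hb (2 * B2 D)) at 2 by lra.
              apply (decay_antitone m b Hb); lra. }
            unfold G; lra. }
      assert (Hz : norm z <= a1i (2 * bt) + a1i (2 * G D)).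
      { rewrite <- (Ha1i (norm z)) by apply norm_ge_0.
        pose proof (class_K_nonneg a1 _ (proj1 Ka1) (norm_ge_0 z)).
        pose proof (proj1 (Ha z)).
        eapply Rle_trans; [| apply (class_K_weak_triangle a1i bt (G D) Ka1i Hbt HG)].
        apply (class_K_le a1i _ _ Ka1i); lra. }
      rewrite (traj_next hS (t := t) x Hd1 Hd2 Hp (k := (p + k)%nat)) by (first [lia | lra]).
      fold z.
      eapply Rle_trans.
      * apply (flow_norm_le (tau (p + k)%nat) (tau (S (p + k)%nat)) (tau (p + k)%nat) t theta2
          z d1 xi2 eta2); trivial; try lra.
        -- eapply alive_on_next; eassumption.
        -- pose proof (hT (p + k)%nat); lra.
      * pose proof (class_K_le eta2 _ _ Keta2 HD1).
        pose proof (class_K_le xi2 _ _ Kxi2 (conj (norm_ge_0 _) Hz)).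
        pose proof (class_K_weak_triangle xi2 _ _ Kxi2
          (class_K_nonneg a1i _ Ka1i (Rmult_le_pos 2 bt ltac:(lra) Hbt))
          (class_K_nonneg a1i _ Ka1i (Rmult_le_pos 2 (G D) ltac:(lra) HG))).
        unfold F; lra.
Qed.
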